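(* Let $l>0$ and let $t$ be a complex number. Let $J_t$ be the semi-infinite Jacobi matrix with diagonal entries $b_1=t$, $b_k=0$ for $k\ge2$, and off-diagonal entries $a_n=\dfrac{l}{\sqrt{(2n-1)(2n+1)}}$, $n=1,2,\ldots$, that is, $$J_t=\begin{pmatrix} t & \frac{l}{\sqrt{1\cdot 3}} & 0 & 0 & \cdots\\ \frac{l}{\sqrt{1\cdot 3}} & 0 & \frac{l}{\sqrt{3\cdot 5}} & 0 & \cdots\\ 0 & \frac{l}{\sqrt{3\cdot 5}} & 0 & \frac{l}{\sqrt{5\cdot 7}} & \cdots\\ \vdots & \vdots & \ddots & \ddots & \ddots\end{pmatrix}.$$ Then for all $t\in\mathbb{C}$ but the two values $t=\pm il$, the corresponding Jacobi operator in $l_2(\mathbb{N})$ has a complete system of eigenvectors.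
   Context: The Jacobi matrix has $b_k$ in position $(k,k)$ and $a_k$ in positions $(k,k+1)$ and $(k+1,k)$, zeros elsewhere; the corresponding Jacobi operator is the bounded operator in $l_2(\mathbb{N})$ given by matrix multiplication. A bounded operator in a Hilbert space has a complete system of eigenvectors if the closed linear span of its eigenvectors is the whole space. *)

(* Defs.v *)
From Stdlib Require Import Reals Lra Lia Psatz Arith.
From Stdlib Require Import FunctionalExtensionality ProofIrrelevance.
From Coquelicot Require Import Coquelicot.

Open Scope R_scope.

(** * The complex Hilbert space l2(N)

    Indices start at 0: the k-th coordinate of the mathematical text
    (k = 1, 2, ...) is the coordinate of index k - 1 here. *)

Definition square_summable (x : nat -> C) : Prop :=
  ex_series (fun n => Cmod (x n) ^ 2).

Record l2 : Type := mk_l2 {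
  l2_seq :> nat -> C;
  l2_summable : square_summable l2_seq
}.

Lemma l2_ext (x y : l2) : (forall n, x n = y n) -> x = y.
Proof.
destruct x as [x Hx], y as [y Hy]; simpl; intros H.
assert (E : x = y) by (apply functional_extensionality; exact H).
subst y; f_equal; apply proof_irrelevance.
Qed.

Lemma square_summable_le (x : nat -> C) (u : nat -> R) :
  (forall n, Cmod (x n) ^ 2 <= u n) -> ex_series u -> square_summable x.
Proof.
intros H Hu; unfold square_summable.
apply (ex_series_le (K := R_AbsRing) (V := R_CompleteNormedModule)) with u; auto.
intros n; unfold norm; simpl; unfold abs; simpl.
rewrite Rabs_pos_eq; [apply H | nra].
Qed.

Lemma ex_series_lin2 (p q : R) (u v : nat -> R) :
  ex_series u -> ex_series v -> ex_series (fun n => p * u n + q * v n).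
Proof.
intros Hu Hv.
apply (ex_series_plus (V := R_NormedModule)
         (fun n => p * u n) (fun n => q * v n)).
- exact (ex_series_scal_l p u Hu).
- exact (ex_series_scal_l q v Hv).
Qed.

Lemma Series_lin2 (p q : R) (u v : nat -> R) :
  ex_series u -> ex_series v ->
  Series (fun n => p * u n + q * v n) = p * Series u + q * Series v.
Proof.
intros Hu Hv.
rewrite Series_plus; [now rewrite !Series_scal_l | |].
- exact (ex_series_scal_l p u Hu).
- exact (ex_series_scal_l q v Hv).
Qed.

Lemma Cmod_plus_sq (s : R) (y z : C) : 0 < s ->
  Cmod (y + z) ^ 2 <= (1 + s) * Cmod y ^ 2 + (1 + / s) * Cmod z ^ 2.
Proof.
intros hs.
pose proof (Cmod_triangle y z) as T; pose proof (Cmod_ge_0 (y + z)) as P.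
set (p := Cmod y) in *; set (q := Cmod z) in *; set (r := Cmod (y + z)) in *.
assert (r ^ 2 <= (p + q) ^ 2) by nra.
assert (E : (1 + s) * p ^ 2 + (1 + / s) * q ^ 2 - (p + q) ^ 2
            = / s * (s * p - q) ^ 2) by (field; lra).
assert (0 <= / s * (s * p - q) ^ 2).
{ apply Rmult_le_pos; [left; now apply Rinv_0_lt_compat | apply pow2_ge_0]. }
lra.
Qed.

Lemma square_summable_zero : square_summable (fun _ => RtoC 0).
Proof.
apply square_summable_le with (fun n => 0 * (1 / 2) ^ n).
- intros n; rewrite Cmod_0; right; ring.
- apply (ex_series_scal_l 0 (fun n => (1 / 2) ^ n)).
  apply ex_series_geom; rewrite Rabs_pos_eq; lra.
Qed.

Lemma square_summable_plus (x y : nat -> C) :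
  square_summable x -> square_summable y ->
  square_summable (fun n => Cplus (x n) (y n)).
Proof.
intros Hx Hy.
apply square_summable_le
  with (fun n => (1 + 1) * Cmod (x n) ^ 2 + (1 + / 1) * Cmod (y n) ^ 2).
- intros n; apply Cmod_plus_sq; lra.
- now apply ex_series_lin2.
Qed.

Lemma square_summable_scal (c : C) (x : nat -> C) :
  square_summable x -> square_summable (fun n => Cmult c (x n)).
Proof.
intros Hx.
apply square_summable_le with (fun n => Cmod c ^ 2 * Cmod (x n) ^ 2).
- intros n; rewrite Cmod_mult; right; ring.
- exact (ex_series_scal_l (Cmod c ^ 2) _ Hx).
Qed.

Lemma square_summable_opp (x : nat -> C) :
  square_summable x -> square_summable (fun n => Copp (x n)).
Proof.
intros Hx; apply square_summable_le with (2 := Hx).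
intros n; rewrite Cmod_opp; lra.
Qed.

Definition l2_zero : l2 := mk_l2 (fun _ => RtoC 0) square_summable_zero.
Definition l2_plus (x y : l2) : l2 :=
  mk_l2 _ (square_summable_plus x y (l2_summable x) (l2_summable y)).
Definition l2_opp (x : l2) : l2 :=
  mk_l2 _ (square_summable_opp x (l2_summable x)).
Definition l2_scal (c : C) (x : l2) : l2 :=
  mk_l2 _ (square_summable_scal c x (l2_summable x)).

Definition l2_norm (x : l2) : R := sqrt (Series (fun n => Cmod (x n) ^ 2)).

Lemma l2_plusC x y : l2_plus x y = l2_plus y x.
Proof. apply l2_ext; intros n; simpl; ring. Qed.
Lemma l2_plusA x y z : l2_plus x (l2_plus y z) = l2_plus (l2_plus x y) z.
Proof. apply l2_ext; intros n; simpl; ring. Qed.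
Lemma l2_plus0 x : l2_plus x l2_zero = x.
Proof. apply l2_ext; intros n; simpl; ring. Qed.
Lemma l2_plusN x : l2_plus x (l2_opp x) = l2_zero.
Proof. apply l2_ext; intros n; simpl; ring. Qed.

Definition l2_AbelianMonoid_mixin : AbelianMonoid.mixin_of l2 :=
  AbelianMonoid.Mixin l2 l2_plus l2_zero l2_plusC l2_plusA l2_plus0.
Canonical l2_AbelianMonoid : AbelianMonoid :=
  AbelianMonoid.Pack l2 l2_AbelianMonoid_mixin l2.
Definition l2_AbelianGroup_mixin : AbelianGroup.mixin_of l2_AbelianMonoid :=
  AbelianGroup.Mixin l2_AbelianMonoid l2_opp l2_plusN.
Canonical l2_AbelianGroup : AbelianGroup :=
  AbelianGroup.Pack l2
    (AbelianGroup.Class l2 l2_AbelianMonoid_mixin l2_AbelianGroup_mixin) l2.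

Lemma l2_scalA (a b : C) x : l2_scal a (l2_scal b x) = l2_scal (Cmult a b) x.
Proof. apply l2_ext; intros n; simpl; ring. Qed.
Lemma l2_scal1 x : l2_scal (RtoC 1) x = x.
Proof. apply l2_ext; intros n; simpl; ring. Qed.
Lemma l2_scalDr (a : C) x y :
  l2_scal a (l2_plus x y) = l2_plus (l2_scal a x) (l2_scal a y).
Proof. apply l2_ext; intros n; simpl; ring. Qed.
Lemma l2_scalDl (a b : C) x :
  l2_scal (Cplus a b) x = l2_plus (l2_scal a x) (l2_scal b x).
Proof. apply l2_ext; intros n; simpl; ring. Qed.

Definition l2_ModuleSpace_mixin : ModuleSpace.mixin_of C_Ring l2_AbelianGroup :=
  ModuleSpace.Mixin C_Ring l2_AbelianGroup
    l2_scal l2_scalA l2_scal1 l2_scalDr l2_scalDl.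
Definition l2_ModuleSpace_class : ModuleSpace.class_of C_Ring l2 :=
  ModuleSpace.Class C_Ring l2 (AbelianGroup.class l2_AbelianGroup)
    l2_ModuleSpace_mixin.
Canonical l2_ModuleSpace : ModuleSpace C_Ring :=
  ModuleSpace.Pack C_Ring l2 l2_ModuleSpace_class l2.

Lemma Series_Cmod2_ge0 (x : nat -> C) : square_summable x ->
  0 <= Series (fun n => Cmod (x n) ^ 2).
Proof.
intros Hx.
rewrite <- (Rmult_0_l (Series (fun n => Cmod (x n) ^ 2))).
rewrite <- Series_scal_l.
apply Series_le; [| exact Hx].
intros n; pose proof (pow2_ge_0 (Cmod (x n))); lra.
Qed.

Lemma l2_norm_ge0 (x : l2) : 0 <= l2_norm x.
Proof. apply sqrt_pos. Qed.

Lemma l2_norm_sq (x : l2) :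
  l2_norm x ^ 2 = Series (fun n => Cmod (x n) ^ 2).
Proof. apply pow2_sqrt, Series_Cmod2_ge0, l2_summable. Qed.

Lemma l2_coord_le (x : l2) (k : nat) : Cmod (x k) <= l2_norm x.
Proof.
apply Rsqr_incr_0_var; [| apply l2_norm_ge0].
rewrite !Rsqr_pow2, l2_norm_sq.
rewrite (Series_incr_n (fun n => Cmod (x n) ^ 2) (S k));
  [| lia | apply l2_summable].
assert (H1 : 0 <= Series (fun n => Cmod (x (S k + n)%nat) ^ 2)).
{ apply (Series_Cmod2_ge0 (fun n => x (S k + n)%nat)).
  apply (ex_series_incr_n (V := R_NormedModule) (fun n => Cmod (x n) ^ 2)).
  apply l2_summable. }
simpl pred.
assert (H2 : Cmod (x k) ^ 2 <= sum_f_R0 (fun n => Cmod (x n) ^ 2) k).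
{ destruct k as [| k].
  - apply Rle_refl.
  - cbn [sum_f_R0].
    pose proof (cond_pos_sum (fun n => Cmod (x n) ^ 2) k
                  (fun n => pow2_ge_0 (Cmod (x n)))).
    lra. }
lra.
Qed.

Lemma l2_norm_eq0 (x : l2) : l2_norm x = 0 -> x = l2_zero.
Proof.
intros H; apply l2_ext; intros n; simpl.
apply Cmod_eq_0; apply Rle_antisym; [| apply Cmod_ge_0].
rewrite <- H; apply l2_coord_le.
Qed.

Lemma l2_norm_zero : l2_norm l2_zero = 0.
Proof.
unfold l2_norm.
rewrite (Series_ext _ (fun n => 0 * Cmod (l2_zero n) ^ 2)).
- now rewrite Series_scal_l, Rmult_0_l, sqrt_0.
- intros n; simpl; rewrite Cmod_0; ring.
Qed.

Lemma l2_norm_triangle (x y : l2) :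
  l2_norm (l2_plus x y) <= l2_norm x + l2_norm y.
Proof.
destruct (Rle_lt_or_eq_dec _ _ (l2_norm_ge0 x)) as [Px | Zx].
2:{ symmetry in Zx; rewrite (l2_norm_eq0 x Zx), l2_plusC, l2_plus0.
    rewrite l2_norm_zero; lra. }
destruct (Rle_lt_or_eq_dec _ _ (l2_norm_ge0 y)) as [Py | Zy].
2:{ symmetry in Zy; rewrite (l2_norm_eq0 y Zy), l2_plus0.
    rewrite l2_norm_zero; lra. }
set (p := l2_norm x) in *; set (q := l2_norm y) in *.
assert (Hs : 0 < q / p) by (now apply Rdiv_lt_0_compat).
apply Rsqr_incr_0_var; [| lra].
rewrite !Rsqr_pow2, l2_norm_sq.
apply Rle_trans with
  (Series (fun n => (1 + q / p) * Cmod (x n) ^ 2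
                    + (1 + / (q / p)) * Cmod (y n) ^ 2)).
- apply Series_le.
  + intros n; split; [apply pow2_ge_0 |].
    now apply Cmod_plus_sq.
  + apply ex_series_lin2; apply l2_summable.
- rewrite Series_lin2 by apply l2_summable.
  rewrite <- !l2_norm_sq; fold p q.
  right; field; lra.
Qed.

Lemma l2_norm_scal (c : C) (x : l2) :
  l2_norm (l2_scal c x) = Cmod c * l2_norm x.
Proof.
unfold l2_norm.
rewrite (Series_ext _ (fun n => Cmod c ^ 2 * Cmod (x n) ^ 2)).
2:{ intros n; simpl l2_seq; rewrite Cmod_mult; ring. }
rewrite Series_scal_l, sqrt_mult_alt by apply pow2_ge_0.
now rewrite sqrt_pow2 by apply Cmod_ge_0.
Qed.

Definition l2_ball (x : l2) (eps : R) (y : l2) : Prop :=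
  l2_norm (minus y x) < eps.

Lemma l2_ball_center (x : l2) (e : posreal) : l2_ball x e x.
Proof.
unfold l2_ball; rewrite minus_eq_zero.
change (l2_norm l2_zero < e); rewrite l2_norm_zero; apply cond_pos.
Qed.

Lemma l2_ball_sym (x y : l2) (e : R) : l2_ball x e y -> l2_ball y e x.
Proof.
unfold l2_ball; intros H.
replace (minus x y) with (l2_scal (RtoC (-1)) (minus y x)).
- rewrite l2_norm_scal, Cmod_R, Rabs_left by lra; lra.
- apply l2_ext; intros n; simpl.
  replace (RtoC (-1)) with (Copp (RtoC 1)); [ring |].
  now rewrite <- RtoC_opp.
Qed.

Lemma l2_ball_triangle (x y z : l2) (e1 e2 : R) :
  l2_ball x e1 y -> l2_ball y e2 z -> l2_ball x (e1 + e2) z.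
Proof.
unfold l2_ball; intros H1 H2.
replace (minus z x) with (l2_plus (minus z y) (minus y x)).
- pose proof (l2_norm_triangle (minus z y) (minus y x)); lra.
- apply l2_ext; intros n; simpl; ring.
Qed.

Definition l2_UniformSpace_mixin : UniformSpace.mixin_of l2 :=
  UniformSpace.Mixin l2 l2_zero l2_ball
    l2_ball_center l2_ball_sym l2_ball_triangle.
Canonical l2_UniformSpace : UniformSpace :=
  UniformSpace.Pack l2 l2_UniformSpace_mixin l2.

Definition l2_NormedModuleAux_class : NormedModuleAux.class_of C_AbsRing l2 :=
  NormedModuleAux.Class C_AbsRing l2
    l2_ModuleSpace_class l2_UniformSpace_mixin.
Canonical l2_NormedModuleAux : NormedModuleAux C_AbsRing :=
  NormedModuleAux.Pack C_AbsRing l2 l2_NormedModuleAux_class l2.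

Lemma l2_norm_scal_le (c : C) (x : l2) :
  l2_norm (l2_scal c x) <= Cmod c * l2_norm x.
Proof. right; apply l2_norm_scal. Qed.

Lemma l2_norm_compat1 (x y : l2) (eps : R) :
  l2_norm (minus y x) < eps -> l2_ball x eps y.
Proof. exact (fun H => H). Qed.

Lemma l2_norm_compat2 (x y : l2) (eps : posreal) :
  l2_ball x eps y -> l2_norm (minus y x) < 1 * eps.
Proof. now rewrite Rmult_1_l. Qed.

Definition l2_NormedModule_mixin :
    NormedModule.mixin_of C_AbsRing l2_NormedModuleAux :=
  NormedModule.Mixin C_AbsRing l2_NormedModuleAux l2_norm 1
    l2_norm_triangle l2_norm_scal_le l2_norm_compat1 l2_norm_compat2
    l2_norm_eq0.
Canonical l2_NormedModule : NormedModule C_AbsRing :=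
  NormedModule.Pack C_AbsRing l2
    (NormedModule.Class C_AbsRing l2
       l2_NormedModuleAux_class l2_NormedModule_mixin) l2.

(** * Complete systems of eigenvectors *)

Definition eigenvector {H : NormedModule C_AbsRing} (T : H -> H) (v : H)
    : Prop :=
  v <> zero /\ exists lambda : C, T v = scal lambda v.

Inductive linear_span {H : NormedModule C_AbsRing} (S : H -> Prop)
    : H -> Prop :=
| span_zero : linear_span S zero
| span_add (c : C) (v y : H) :
    S v -> linear_span S y -> linear_span S (plus (scal c v) y).

Definition closed_linear_span {H : NormedModule C_AbsRing} (S : H -> Prop)
    (x : H) : Prop :=
  forall eps : posreal, exists y : H, linear_span S y /\ ball x eps y.

Definition complete_system_of_eigenvectors {H : NormedModule C_AbsRing}
    (T : H -> H) : Prop :=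
  forall x : H, closed_linear_span (eigenvector T) x.

(** * Jacobi operators *)

Definition bounded_seq (u : nat -> C) : Prop :=
  exists M : R, forall n, Cmod (u n) <= M.

Definition jacobi_matrix (a b : nat -> C) (i j : nat) : C :=
  if Nat.eqb j i then b i
  else if Nat.eqb j (S i) then a i
  else if Nat.eqb i (S j) then a j
  else RtoC 0.

(** Row [i] of the matrix vanishes beyond column [i + 1], so that the sum
    below is the whole matrix product; see [jacobi_apply_matrix]. *)
Definition jacobi_apply (a b x : nat -> C) (i : nat) : C :=
  sum_n (fun j => Cmult (jacobi_matrix a b i j) (x j)) (S i).

Lemma jacobi_apply_matrix (a b x : nat -> C) (i : nat) :
  is_series (fun j => Cmult (jacobi_matrix a b i j) (x j))
    (jacobi_apply a b x i).
Proof.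
apply (is_series_decr_n (V := C_NormedModule) _ (S (S i))); [lia |].
simpl pred; unfold jacobi_apply.
rewrite (plus_opp_r (G := C_AbelianGroup)).
apply (filterlim_ext (fun _ : nat => (zero : C_NormedModule))).
2: apply filterlim_const.
intros n; symmetry.
rewrite (sum_n_ext _ (fun _ => zero : C_NormedModule)).
- unfold sum_n; induction n as [| n IH].
  + now rewrite sum_n_n.
  + rewrite sum_n_Sm by lia; rewrite IH; apply plus_zero_l.
- intros j; unfold jacobi_matrix.
  destruct (Nat.eqb_spec (S (S i) + j) i) as [E | _]; [lia |].
  destruct (Nat.eqb_spec (S (S i) + j) (S i)) as [E | _]; [lia |].
  destruct (Nat.eqb_spec i (S (S (S i) + j))) as [E | _]; [lia |].
  apply Cmult_0_l.
Qed.

Lemma jacobi_apply_0 (a b x : nat -> C) :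
  jacobi_apply a b x 0 = Cplus (Cmult (b 0%nat) (x 0%nat))
                               (Cmult (a 0%nat) (x 1%nat)).
Proof. unfold jacobi_apply; rewrite sum_Sn, sum_O; reflexivity. Qed.

Lemma jacobi_apply_S (a b x : nat -> C) (i : nat) :
  jacobi_apply a b x (S i) =
  Cplus (Cplus (Cmult (a i) (x i)) (Cmult (b (S i)) (x (S i))))
        (Cmult (a (S i)) (x (S (S i)))).
Proof.
unfold jacobi_apply; rewrite !sum_Sn.
assert (E : sum_n (fun j => Cmult (jacobi_matrix a b (S i) j) (x j)) i
            = Cmult (a i) (x i)).
{ destruct i as [| i].
  - rewrite sum_O; reflexivity.
  - rewrite sum_Sn.
    rewrite (sum_n_ext_loc _ (fun _ => zero : C_NormedModule)).
    + replace (sum_n (fun _ => zero : C_NormedModule) i)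
        with (zero : C_NormedModule).
      * rewrite plus_zero_l; unfold jacobi_matrix.
        destruct (Nat.eqb_spec (S i) (S (S i))) as [F | _]; [lia |].
        destruct (Nat.eqb_spec (S i) (S (S (S i)))) as [F | _]; [lia |].
        now rewrite Nat.eqb_refl.
      * clear; induction i as [| i IH]; [now rewrite sum_O |].
        rewrite sum_Sn, <- IH; symmetry; apply plus_zero_l.
    + intros j Hj; unfold jacobi_matrix.
      destruct (Nat.eqb_spec j (S (S i))) as [F | _]; [lia |].
      destruct (Nat.eqb_spec j (S (S (S i)))) as [F | _]; [lia |].
      destruct (Nat.eqb_spec (S (S i)) (S j)) as [F | _]; [lia |].
      apply Cmult_0_l. }
rewrite E; unfold jacobi_matrix.
rewrite !Nat.eqb_refl.
destruct (Nat.eqb_spec (S (S i)) (S i)) as [F | _]; [lia |].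
reflexivity.
Qed.

Definition shift_right (x : nat -> C) (i : nat) : C :=
  match i with O => RtoC 0 | S j => x j end.

Lemma shift_right_summable (x : nat -> C) :
  square_summable x -> square_summable (shift_right x).
Proof.
intros Hx; unfold square_summable.
apply (ex_series_incr_1 (V := R_NormedModule)
         (fun n => Cmod (shift_right x n) ^ 2)).
exact Hx.
Qed.

Lemma shift_left_summable (x : nat -> C) :
  square_summable x -> square_summable (fun n => x (S n)).
Proof.
intros Hx.
exact (proj1 (ex_series_incr_1 (V := R_NormedModule)
                (fun n => Cmod (x n) ^ 2)) Hx).
Qed.

Lemma Cmod_sum3_sq (M : R) (a b c x y z : C) :
  Cmod a <= M -> Cmod b <= M -> Cmod c <= M ->
  Cmod (a * x + b * y + c * z) ^ 2
  <= 3 * M ^ 2 * Cmod x ^ 2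
     + 1 * (3 * M ^ 2 * Cmod y ^ 2 + 3 * M ^ 2 * Cmod z ^ 2).
Proof.
intros Ha Hb Hc.
pose proof (Cmod_triangle (a * x + b * y) (c * z)) as T1.
pose proof (Cmod_triangle (a * x) (b * y)) as T2.
rewrite !Cmod_mult in *.
pose proof (Cmod_ge_0 (a * x + b * y + c * z)) as P.
pose proof (Cmod_ge_0 x) as Px; pose proof (Cmod_ge_0 y) as Py.
pose proof (Cmod_ge_0 z) as Pz.
set (r := Cmod (a * x + b * y + c * z)) in *.
set (p := Cmod x) in *; set (q := Cmod y) in *; set (w := Cmod z) in *.
assert (H : r <= M * (p + q + w)) by nra.
assert (H2 : r ^ 2 <= (M * (p + q + w)) ^ 2) by (apply pow_incr; lra).
assert (H3 : (p + q + w) ^ 2 <= 3 * (p ^ 2 + q ^ 2 + w ^ 2)).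
{ pose proof (pow2_ge_0 (p - q)); pose proof (pow2_ge_0 (p - w)).
  pose proof (pow2_ge_0 (q - w)); lra. }
rewrite Rpow_mult_distr in H2.
pose proof (Rmult_le_compat_l _ _ _ (pow2_ge_0 M) H3).
lra.
Qed.

Lemma jacobi_apply_shift (a b x : nat -> C) (i : nat) :
  jacobi_apply a b x i =
  Cplus (Cplus (Cmult (shift_right a i) (shift_right x i)) (Cmult (b i) (x i)))
        (Cmult (a i) (x (S i))).
Proof.
destruct i as [| i]; simpl shift_right.
- rewrite jacobi_apply_0; ring.
- apply jacobi_apply_S.
Qed.

Lemma jacobi_apply_le (M : R) (a b x : nat -> C) (i : nat) :
  (forall n, Cmod (a n) <= M) -> (forall n, Cmod (b n) <= M) ->
  Cmod (jacobi_apply a b x i) ^ 2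
  <= 3 * M ^ 2 * Cmod (shift_right x i) ^ 2
     + 1 * (3 * M ^ 2 * Cmod (x i) ^ 2 + 3 * M ^ 2 * Cmod (x (S i)) ^ 2).
Proof.
intros Ha Hb; rewrite jacobi_apply_shift; apply Cmod_sum3_sq; auto.
destruct i as [| i]; simpl; auto.
rewrite Cmod_0; apply Rle_trans with (2 := Ha 0%nat); apply Cmod_ge_0.
Qed.

Lemma jacobi_apply_summable (a b : nat -> C) (x : nat -> C) :
  bounded_seq a -> bounded_seq b ->
  square_summable x -> square_summable (jacobi_apply a b x).
Proof.
intros [Ma Ha] [Mb Hb] Hx.
eapply square_summable_le.
- intros n; apply (jacobi_apply_le (Rmax Ma Mb)).
  + intros k; eapply Rle_trans; [apply Ha | apply Rmax_l].
  + intros k; eapply Rle_trans; [apply Hb | apply Rmax_r].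
- apply ex_series_lin2; [now apply shift_right_summable |].
  apply ex_series_lin2; [exact Hx | now apply shift_left_summable].
Qed.

Definition jacobi_operator (a b : nat -> C)
    (Ha : bounded_seq a) (Hb : bounded_seq b) (x : l2) : l2 :=
  mk_l2 (jacobi_apply a b x)
        (jacobi_apply_summable a b x Ha Hb (l2_summable x)).

(** [is_linear] includes continuity. *)
Lemma jacobi_operator_is_linear (a b : nat -> C)
    (Ha : bounded_seq a) (Hb : bounded_seq b) :
  is_linear (U := l2_NormedModule) (V := l2_NormedModule)
    (jacobi_operator a b Ha Hb).
Proof.
split.
- intros x y; apply l2_ext; intros i; simpl.
  rewrite !jacobi_apply_shift; simpl.
  destruct i as [| i]; simpl; ring.
- intros c x; apply l2_ext; intros i; simpl.
  rewrite !jacobi_apply_shift; simpl.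
  destruct i as [| i]; simpl; ring.
- generalize Ha Hb; intros [Ma Ha'] [Mb Hb'].
  set (M := Rmax Ma Mb).
  assert (HMa : forall k, Cmod (a k) <= M).
  { intros k; eapply Rle_trans; [apply Ha' | apply Rmax_l]. }
  assert (HMb : forall k, Cmod (b k) <= M).
  { intros k; eapply Rle_trans; [apply Hb' | apply Rmax_r]. }
  assert (PM : 0 <= M)
    by (apply Rle_trans with (2 := HMa 0%nat); apply Cmod_ge_0).
  exists (3 * M + 1); split; [lra |].
  intros x; change (l2_norm (jacobi_operator a b Ha Hb x)
                    <= (3 * M + 1) * l2_norm x).
  pose proof (l2_norm_ge0 x) as Px.
  apply Rle_trans with (3 * M * l2_norm x); [| lra].
  apply Rsqr_incr_0_var; [| apply Rmult_le_pos; lra].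
  rewrite !Rsqr_pow2, l2_norm_sq.
  pose proof (l2_summable x) as Sx.
  pose proof (shift_right_summable x Sx) as Sr.
  pose proof (shift_left_summable x Sx) as Sl.
  eapply Rle_trans.
  + apply Series_le.
    * intros n; split; [apply pow2_ge_0 |].
      now apply (jacobi_apply_le M).
    * apply ex_series_lin2; [exact Sr |].
      apply ex_series_lin2; [exact Sx | exact Sl].
  + rewrite Series_lin2; [| exact Sr | now apply ex_series_lin2].
    rewrite Series_lin2; [| exact Sx | exact Sl].
    assert (E1 : Series (fun n => Cmod (shift_right x n) ^ 2)
                 = l2_norm x ^ 2).
    { rewrite Series_incr_1 by exact Sr; simpl shift_right.
      rewrite Cmod_0, l2_norm_sq; ring. }
    assert (E2 : Series (fun n => Cmod (x (S n)) ^ 2) <= l2_norm x ^ 2).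
    { rewrite l2_norm_sq, (Series_incr_1 (fun n => Cmod (x n) ^ 2))
        by exact Sx.
      pose proof (pow2_ge_0 (Cmod (x 0%nat))); lra. }
    rewrite E1, <- l2_norm_sq.
    pose proof (Rmult_le_compat_l _ _ _ (pow2_ge_0 M) E2).
    lra.
Qed.

(** * The matrix J_t

    With indices starting at 0, the entry of index [n] is a_{n+1} (resp.
    b_{n+1}). *)

Definition Jt_offdiag (l : R) (n : nat) : C :=
  RtoC (l / sqrt ((2 * INR (S n) - 1) * (2 * INR (S n) + 1))).

Definition Jt_diag (t : C) (n : nat) : C :=
  match n with O => t | S _ => RtoC 0 end.

Lemma Jt_offdiag_bounded (l : R) : bounded_seq (Jt_offdiag l).
Proof.
exists (Rabs l); intros n; unfold Jt_offdiag; rewrite Cmod_R.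
rewrite S_INR; pose proof (pos_INR n) as P.
set (d := (2 * (INR n + 1) - 1) * (2 * (INR n + 1) + 1)).
assert (Hd : 1 <= sqrt d).
{ rewrite <- sqrt_1; apply sqrt_le_1_alt; unfold d; nra. }
unfold Rdiv; rewrite Rabs_mult, Rabs_inv, (Rabs_pos_eq (sqrt d)) by lra.
rewrite <- (Rmult_1_r (Rabs l)) at 2.
apply Rmult_le_compat_l; [apply Rabs_pos |].
rewrite <- Rinv_1; apply Rinv_le_contravar; lra.
Qed.

Lemma Jt_diag_bounded (t : C) : bounded_seq (Jt_diag t).
Proof.
exists (Cmod t); intros [| n]; simpl; [lra |].
rewrite Cmod_0; apply Cmod_ge_0.
Qed.

Definition Jt_operator (l : R) (t : C) : l2 -> l2 :=
  jacobi_operator (Jt_offdiag l) (Jt_diag t)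
    (Jt_offdiag_bounded l) (Jt_diag_bounded t).

(* Main.v *)
(** After conjugation by the powers of -i, expansion in normalised Legendre
    polynomials on [-1, 1] turns J_t into a map on functions with
      J_t (f') = i l f + ((t - il) f(1) - (t + il) f(-1)) e_0,
    because (2n+1) P_n = P_{n+1}' - P_{n-1}'.  Hence every exponential
    E(x) = exp(k x) with (t - il) E(1) = (t + il) E(-1) is an eigenfunction; for
    t <> il, -il such a k exists, and k + i pi m is then admissible for every
    integer m.  So E times any trigonometric polynomial of period 2 lies in the
    span of the eigenvectors, and so, in the limit, does x E(x), as x is an L^2 limit
    of such polynomials; Bessel's inequality carries L^2 limits to l2.  Since x E(x)
    violates the boundary condition, applying J_t to its derivative shows that
    e_0 is in the closed span, and e_0 is cyclic for J_t. *)

Require Import Defs.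
From Stdlib Require Import Reals Lra Lia.
From Coquelicot Require Import Coquelicot.

Open Scope R_scope.

(** * Continuous functions and integration over [-1, 1] *)

Definition cts (f : R -> R) : Prop := forall x, continuous f x.

Lemma cts_derive (f df : R -> R) : (forall x : R, is_derive f x (df x)) -> cts f.
Proof.
intros H x; apply (ex_derive_continuous (V := R_NormedModule)).
now exists (df x).
Qed.

Lemma cts_const (c : R) : cts (fun _ => c).
Proof. intros x; apply continuous_const. Qed.

Lemma cts_id : cts (fun x => x).
Proof. intros x; apply continuous_id. Qed.

Lemma cts_mult (f g : R -> R) : cts f -> cts g -> cts (fun x => f x * g x).
Proof. intros Hf Hg x; now apply (continuous_mult (K := R_AbsRing)). Qed.

Lemma cts_plus (f g : R -> R) : cts f -> cts g -> cts (fun x => f x + g x).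
Proof. intros Hf Hg x; now apply (continuous_plus (V := R_NormedModule)). Qed.

Lemma cts_minus (f g : R -> R) : cts f -> cts g -> cts (fun x => f x - g x).
Proof. intros Hf Hg x; now apply (continuous_minus (V := R_NormedModule)). Qed.

Lemma cts_pow (f : R -> R) (n : nat) : cts f -> cts (fun x => f x ^ n).
Proof.
intros Hf; induction n as [| n IH]; [exact (cts_const 1) |].
exact (cts_mult _ _ Hf IH).
Qed.

Create HintDb cts discriminated.
#[global] Hint Resolve cts_const cts_id cts_mult cts_plus cts_minus cts_pow : cts.

Definition Int (f : R -> R) : R := RInt f (-1) 1.

Lemma cts_ex_RInt (f : R -> R) : cts f -> ex_RInt f (-1) 1.
Proof. intros Hf; apply (ex_RInt_continuous (V := R_CompleteNormedModule)); auto. Qed.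

Lemma Int_ext (f g : R -> R) : (forall x, f x = g x) -> Int f = Int g.
Proof. intros H; apply RInt_ext; auto. Qed.

Lemma Int_lin (a b : R) (f g : R -> R) : cts f -> cts g ->
  Int (fun x => a * f x + b * g x) = a * Int f + b * Int g.
Proof.
intros Hf Hg; unfold Int.
rewrite (RInt_plus (V := R_CompleteNormedModule)
           (fun x => a * f x) (fun x => b * g x));
  try (apply cts_ex_RInt; auto with cts).
rewrite (RInt_scal (V := R_CompleteNormedModule) f); [| now apply cts_ex_RInt].
rewrite (RInt_scal (V := R_CompleteNormedModule) g); [| now apply cts_ex_RInt].
reflexivity.
Qed.

Lemma Int_scal (a : R) (f : R -> R) : cts f -> Int (fun x => a * f x) = a * Int f.
Proof.
intros Hf; rewrite (Int_ext _ (fun x => a * f x + 0 * f x)) by (intros; ring).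
rewrite Int_lin by auto; ring.
Qed.

Lemma Int_le (f g : R -> R) : cts f -> cts g ->
  (forall x, -1 <= x <= 1 -> f x <= g x) -> Int f <= Int g.
Proof.
intros Hf Hg H; apply RInt_le; try apply cts_ex_RInt; auto; try lra.
intros x Hx; apply H; lra.
Qed.

Lemma Int_derive (f df : R -> R) : (forall x : R, is_derive f x (df x)) -> cts df ->
  Int df = f 1 - f (-1).
Proof.
intros H Hc; apply (is_RInt_unique (V := R_CompleteNormedModule)).
apply (is_RInt_derive (V := R_CompleteNormedModule) f df); auto.
Qed.

Lemma Int_by_parts (f g df dg : R -> R) :
  (forall x : R, is_derive f x (df x)) -> (forall x, is_derive g x (dg x)) ->
  cts df -> cts dg ->
  Int (fun x => df x * g x) =
  f 1 * g 1 - f (-1) * g (-1) - Int (fun x => f x * dg x).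
Proof.
intros Hf Hg Hdf Hdg.
assert (Cf := cts_derive _ _ Hf); assert (Cg := cts_derive _ _ Hg).
rewrite <- (Int_derive (fun x => f x * g x) (fun x => df x * g x + f x * dg x)).
- rewrite (Int_ext (fun x => df x * g x + f x * dg x)
             (fun x => 1 * (df x * g x) + 1 * (f x * dg x))) by (intros; ring).
  rewrite Int_lin by auto with cts; ring.
- intros x; apply (is_derive_mult (K := R_AbsRing) f g); auto.
  intros; apply Rmult_comm.
- auto with cts.
Qed.

(** * Legendre polynomials *)

(** Bonnet's three-term recurrence, which needs no theory of polynomials. [dleg] is the same
    recurrence differentiated formally. *)
Fixpoint leg (n : nat) : R -> R :=
  match n with
  | O => fun _ => 1
  | S m =>
    match m with
    | O => fun x => x
    | S k => fun x =>
        ((2 * INR m + 1) * x * leg m x - INR m * leg k x) / INR (S m)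
    end
  end.

Fixpoint dleg (n : nat) : R -> R :=
  match n with
  | O => fun _ => 0
  | S m =>
    match m with
    | O => fun _ => 1
    | S k => fun x =>
        ((2 * INR m + 1) * (leg m x + x * dleg m x) - INR m * dleg k x)
          / INR (S m)
    end
  end.

Lemma leg_SS (n : nat) (x : R) :
  (INR n + 2) * leg (S (S n)) x =
  (2 * INR n + 3) * x * leg (S n) x - (INR n + 1) * leg n x.
Proof.
change (leg (S (S n)) x) with
  (((2 * INR (S n) + 1) * x * leg (S n) x - INR (S n) * leg n x) / INR (S (S n))).
rewrite !S_INR; field; pose proof (pos_INR n); lra.
Qed.

Lemma dleg_SS (n : nat) (x : R) :
  (INR n + 2) * dleg (S (S n)) x =
  (2 * INR n + 3) * (leg (S n) x + x * dleg (S n) x) - (INR n + 1) * dleg n x.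
Proof.
change (dleg (S (S n)) x) with
  (((2 * INR (S n) + 1) * (leg (S n) x + x * dleg (S n) x)
     - INR (S n) * dleg n x) / INR (S (S n))).
rewrite !S_INR; field; pose proof (pos_INR n); lra.
Qed.

Lemma nat_ind2 (P : nat -> Prop) :
  P 0%nat -> P 1%nat -> (forall n, P n -> P (S n) -> P (S (S n))) ->
  forall n, P n.
Proof.
intros H0 H1 HS n; enough (P n /\ P (S n)) by tauto.
induction n as [| n [IH1 IH2]]; auto.
Qed.

Lemma is_derive_leg (n : nat) (x : R) : is_derive (leg n) x (dleg n x).
Proof.
revert n; apply nat_ind2;
  [exact (is_derive_const (V := R_NormedModule) 1 x)
  | exact (is_derive_id (K := R_AbsRing) x) | ].
intros n H0 H1.
pose proof (pos_INR n).
apply (is_derive_ext (fun y =>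
  ((2 * INR n + 3) / (INR n + 2)) * (y * leg (S n) y)
    - ((INR n + 1) / (INR n + 2)) * leg n y)).
{ intros y; apply Rmult_eq_reg_l with (INR n + 2); [| lra].
  rewrite leg_SS; field; lra. }
assert (E : dleg (S (S n)) x =
  (2 * INR n + 3) / (INR n + 2) * (1 * leg (S n) x + x * dleg (S n) x)
  - (INR n + 1) / (INR n + 2) * dleg n x).
{ apply Rmult_eq_reg_l with (INR n + 2); [| lra].
  rewrite dleg_SS; field; lra. }
rewrite E.
apply (is_derive_minus (V := R_NormedModule)
  (fun y => (2 * INR n + 3) / (INR n + 2) * (y * leg (S n) y))
  (fun y => (INR n + 1) / (INR n + 2) * leg n y)); apply is_derive_scal; [| exact H0].
apply (is_derive_mult (K := R_AbsRing) (fun y => y) (leg (S n))); auto.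
- apply (is_derive_id (K := R_AbsRing)).
- intros; apply Rmult_comm.
Qed.

Lemma cts_leg (n : nat) : cts (leg n).
Proof. apply (cts_derive _ (dleg n)); intros x; apply is_derive_leg. Qed.

Lemma cts_dleg (n : nat) : cts (dleg n).
Proof.
revert n; apply nat_ind2; [apply cts_const .. |].
intros n H0 H1; unfold dleg; fold dleg.
unfold Rdiv; pose proof (cts_leg (S n)); auto 10 with cts.
Qed.
#[global] Hint Resolve cts_leg cts_dleg : cts.

(* The two relations reproduce each other under the recurrence, so they are
   proved together. *)
Lemma dleg_relations (n : nat) (x : R) :
  x * dleg (S n) x = (INR n + 1) * leg (S n) x + dleg n x /\
  dleg (S n) x = x * dleg n x + (INR n + 1) * leg n x.
Proof.
induction n as [| n [B A]]; [simpl; split; ring |].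
pose proof (pos_INR n).
pose proof (leg_SS n x) as L; pose proof (dleg_SS n x) as D.
rewrite S_INR.
assert (A' : dleg (S (S n)) x = x * dleg (S n) x + (INR n + 1 + 1) * leg (S n) x).
{ apply Rmult_eq_reg_l with (INR n + 2); [| lra]. rewrite D; nra. }
split; [| exact A'].
rewrite A'.
replace ((INR n + 1 + 1) * leg (S (S n)) x) with ((INR n + 2) * leg (S (S n)) x) by ring.
rewrite L.
(* What is left is the classical formula for (x^2 - 1) P'; eliminating [dleg n x] between [A] and
   [B] proves it. *)
enough ((x * x - 1) * dleg (S n) x = (INR n + 1) * (x * leg (S n) x - leg n x)) by lra.
replace ((x * x - 1) * dleg (S n) x) with (x * (x * dleg (S n) x) - dleg (S n) x) by ring.
rewrite B at 1; rewrite A; ring.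
Qed.

(** Elimination of [x * dleg (S n) x] from the two relations. This gives each Legendre polynomial of
    positive degree an explicit antiderivative. *)
Lemma dleg_diff (n : nat) (x : R) :
  dleg (S (S n)) x - dleg n x = (2 * INR n + 3) * leg (S n) x.
Proof.
destruct (dleg_relations n x) as [B A], (dleg_relations (S n) x) as [_ A'].
rewrite S_INR in A'; lra.
Qed.

Lemma leg_1 (n : nat) : leg n 1 = 1.
Proof.
revert n; apply nat_ind2; [reflexivity .. |]; intros n H0 H1.
pose proof (pos_INR n).
apply Rmult_eq_reg_l with (INR n + 2); [| lra].
rewrite leg_SS, H0, H1; ring.
Qed.

(** By parity, P_n(-1) = (-1)^n. Together with [leg_1] this cancels the endpoint terms of P_{n+2} -
    P_n. *)
Lemma leg_SS_opp1 (n : nat) : leg (S (S n)) (-1) = leg n (-1).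
Proof.
enough (E : forall n, leg n (-1) = (-1) ^ n) by (rewrite !E; simpl; ring).
clear n; apply nat_ind2; [simpl; ring .. |]; intros n H0 H1.
pose proof (pos_INR n).
apply Rmult_eq_reg_l with (INR n + 2); [| lra].
rewrite leg_SS, H0, H1; simpl; ring.
Qed.

Lemma Int_leg_S (n : nat) : Int (leg (S n)) = 0.
Proof.
pose proof (pos_INR n).
apply Rmult_eq_reg_l with (2 * INR n + 3); [| lra].
rewrite <- Int_scal, Rmult_0_r by auto with cts.
rewrite (Int_derive (fun x => leg (S (S n)) x - leg n x)).
- rewrite !leg_1, leg_SS_opp1; ring.
- intros x; rewrite <- dleg_diff.
  apply (is_derive_minus (V := R_NormedModule)); apply is_derive_leg.
- auto with cts.
Qed.

Lemma Int_leg_recurrence (n m : nat) :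
  (INR n + 2) * Int (fun x => leg (S (S n)) x * leg m x)
  + (INR n + 1) * Int (fun x => leg n x * leg m x)
  = (2 * INR n + 3) * Int (fun x => x * leg (S n) x * leg m x).
Proof.
rewrite <- Int_lin, <- Int_scal by auto with cts.
apply Int_ext; intros x.
pose proof (leg_SS n x) as L.
replace ((INR n + 2) * (leg (S (S n)) x * leg m x)) with
  ((INR n + 2) * leg (S (S n)) x * leg m x) by ring.
rewrite L; ring.
Qed.

Definition kron (n m : nat) : R := if Nat.eqb n m then 2 / (2 * INR n + 1) else 0.

(* Multiplication by [x] is symmetric, which lets the recurrence trade the index [m] for [n]. *)
Lemma leg_orthogonal (m n : nat) :
  Int (fun x => leg n x * leg m x) = kron n m.
Proof.
assert (H0 : forall n, Int (fun x => leg n x * leg 0 x) = kron n 0).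
{ intros [| k]; unfold kron; simpl Nat.eqb; cbv iota.
  - rewrite (Int_derive (fun x => x)); [simpl; lra | | intros x; simpl; apply continuous_const].
    intros x; simpl; rewrite Rmult_1_r; apply (is_derive_id (K := R_AbsRing)).
  - rewrite <- (Int_leg_S k); apply Int_ext; intros x; simpl leg; ring. }
(* The base case [m = 1] in disguise, as [leg 1 x] is [x]: the recurrence reduces it to [H0]. *)
assert (HX : forall n, (2 * INR n + 1) * Int (fun x => x * leg n x * leg 0 x)
                       = if Nat.eqb n 1 then 2 else 0).
{ intros [| k].
  - rewrite (Int_ext _ (leg 1)) by (intros x; simpl; ring).
    rewrite Int_leg_S; simpl; ring.
  - rewrite S_INR; replace (2 * (INR k + 1) + 1) with (2 * INR k + 3) by ring.
    rewrite <- Int_leg_recurrence, !H0; unfold kron.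
    destruct k; simpl; lra. }
revert n; induction m as [| | m IH0 IH1] using nat_ind2; [exact H0 | |].
- intros n; pose proof (pos_INR n).
  apply Rmult_eq_reg_l with (2 * INR n + 1); [| lra].
  rewrite (Int_ext _ (fun x => x * leg n x * leg 0 x)) by (intros x; simpl; ring).
  rewrite HX; unfold kron; destruct (Nat.eqb_spec n 1); [subst; simpl; lra | ring].
- intros n; pose proof (pos_INR m); pose proof (pos_INR n).
  assert (E : (INR m + 2) * Int (fun x => leg n x * leg (S (S m)) x) + (INR m + 1) * kron n m
    = (2 * INR m + 3) * Int (fun x => x * leg n x * leg (S m) x)).
  { rewrite <- IH0.
    rewrite (Int_ext _ (fun x => leg (S (S m)) x * leg n x)) by (intros; ring).
    rewrite (Int_ext (fun x => leg n x * leg m x) (fun x => leg m x * leg n x)) by (intros; ring).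
    rewrite Int_leg_recurrence; f_equal; apply Int_ext; intros; ring. }
  (* For [n = 0] the recurrence in [n] has no predecessor; there [x * leg 0 x] is [leg 1 x] and
     [IH1] applies at once. *)
  destruct n as [| k].
  + rewrite (Int_ext (fun x => x * leg 0 x * leg (S m) x)
              (fun x => leg 1 x * leg (S m) x)) in E
      by (intros x; change (leg 1 x) with x; change (leg 0 x) with 1; ring).
    rewrite IH1 in E; apply Rmult_eq_reg_l with (INR m + 2); [| lra].
    unfold kron in *; destruct m; simpl in *; lra.
  + pose proof (Int_leg_recurrence k (S m)) as F; rewrite !IH1 in F.
    apply (f_equal (fun z => (2 * INR k + 3) * z)) in E.
    replace ((2 * INR k + 3) * ((2 * INR m + 3) * Int (fun x => x * leg (S k) x * leg (S m) x)))
      with ((2 * INR m + 3) * ((2 * INR k + 3) * Int (fun x => x * leg (S k) x * leg (S m) x))) in E by ring.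
    rewrite <- F in E.
    pose proof (pos_INR k).
    apply Rmult_eq_reg_l with ((2 * INR k + 3) * (INR m + 2));
      [| apply Rmult_integral_contrapositive_currified; lra].
    match goal with |- _ * ?I = _ => set (I0 := I) in * end.
    (* All integrals but the wanted one are now known, so an identity between values of [kron]
       remains. Its terms are nonzero only for [S k = m] and for [k = S m]. *)
    enough (G : (2 * INR m + 3) * ((INR k + 2) * kron (S (S k)) (S m) + (INR k + 1) * kron k (S m))
             - (2 * INR k + 3) * ((INR m + 1) * kron (S k) m)
             = (2 * INR k + 3) * (INR m + 2) * kron (S k) (S (S m))) by lra.
    clear; unfold kron.
    destruct (Nat.eq_dec (S k) m) as [<- |]; [| destruct (Nat.eq_dec k (S m)) as [-> |]].
    * rewrite !Nat.eqb_refl.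
      destruct (Nat.eqb_spec k (S (S k))), (Nat.eqb_spec (S k) (S (S (S k)))); try lia.
      rewrite !S_INR; pose proof (pos_INR k); field; lra.
    * rewrite !Nat.eqb_refl.
      destruct (Nat.eqb_spec (S (S (S m))) (S m)), (Nat.eqb_spec (S (S m)) m); try lia.
      rewrite !S_INR; pose proof (pos_INR m); field; lra.
    * destruct (Nat.eqb_spec (S (S k)) (S m)), (Nat.eqb_spec k (S m)),
        (Nat.eqb_spec (S k) m), (Nat.eqb_spec (S k) (S (S m))); try lia; ring.
Qed.

(** * Bessel's inequality and the map to l2 *)

Definition lcoef (u : R -> R) (n : nat) : R := Int (fun x => u x * leg n x).

(** What remains of [u] after its projection onto the first [N] Legendre polynomials is removed;
    (2n+1)/2 is the inverse of the squared norm of P_n. *)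
Fixpoint residual (u : R -> R) (N : nat) : R -> R :=
  match N with
  | O => u
  | S n => fun x => residual u n x - (2 * INR n + 1) / 2 * lcoef u n * leg n x
  end.

Lemma cts_residual (u : R -> R) (N : nat) : cts u -> cts (residual u N).
Proof. intros Hu; induction N as [| n IH]; simpl; auto with cts. Qed.

Lemma lcoef_residual (u : R -> R) (N m : nat) : cts u -> (N <= m)%nat ->
  Int (fun x => residual u N x * leg m x) = lcoef u m.
Proof.
intros Hu; induction N as [| n IH]; intros Hm; [reflexivity |].
pose proof (cts_residual u n Hu).
rewrite (Int_ext _ (fun x => 1 * (residual u n x * leg m x)
           + - ((2 * INR n + 1) / 2 * lcoef u n) * (leg n x * leg m x)))
  by (intros x; simpl; ring).
rewrite Int_lin, IH, leg_orthogonal by (auto with cts; lia).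
unfold kron; destruct (Nat.eqb_spec n m); [lia | ring].
Qed.

(** Pythagoras, one polynomial at a time: each step lowers the squared norm of the residual by
    (2n+1)/2 times the squared coefficient, and the last residual still has a nonnegative squared
    norm. *)
Lemma bessel (u : R -> R) (N : nat) : cts u ->
  sum_n (fun n => (2 * INR n + 1) * lcoef u n ^ 2) N <= 2 * Int (fun x => u x ^ 2).
Proof.
intros Hu.
assert (S : forall n, Int (fun x => residual u (S n) x ^ 2) =
  Int (fun x => residual u n x ^ 2) - (2 * INR n + 1) / 2 * lcoef u n ^ 2).
{ intros n; pose proof (cts_residual u n Hu); pose proof (pos_INR n).
  set (c := (2 * INR n + 1) / 2 * lcoef u n).
  rewrite (Int_ext _ (fun x => 1 * (residual u n x ^ 2 - 2 * c * (residual u n x * leg n x))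
             + c ^ 2 * (leg n x * leg n x))) by (intros x; simpl; fold c; ring).
  rewrite Int_lin by auto with cts.
  rewrite (Int_ext _ (fun x => 1 * residual u n x ^ 2 + - (2 * c) * (residual u n x * leg n x)))
    by (intros; ring).
  rewrite Int_lin, lcoef_residual, leg_orthogonal by auto with cts.
  unfold kron; rewrite Nat.eqb_refl; unfold c; field; lra. }
assert (E : Int (fun x => residual u (Datatypes.S N) x ^ 2) = Int (fun x => u x ^ 2)
  - / 2 * sum_n (fun n => (2 * INR n + 1) * lcoef u n ^ 2) N).
{ induction N as [| N IH].
  - rewrite S, sum_O; simpl residual; field.
  - rewrite S, IH, sum_Sn; change plus with Rplus; cbv beta; field. }
assert (P : Int (fun _ => 0) <= Int (fun x => residual u (Datatypes.S N) x ^ 2)).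
{ pose proof (cts_residual u (Datatypes.S N) Hu).
  apply Int_le; auto with cts; intros x _; apply pow2_ge_0. }
rewrite (Int_ext _ (fun _ => 0 * 0)), Int_scal in P by (auto with cts; intros; ring).
lra.
Qed.

Definition ccts (f : R -> C) : Prop :=
  cts (fun x => fst (f x)) /\ cts (fun x => snd (f x)).

Definition clcoef (f : R -> C) (n : nat) : C :=
  (lcoef (fun x => fst (f x)) n, lcoef (fun x => snd (f x)) n).

(* The factor (-i)^n turns multiplication of Legendre series by the antisymmetric
   integration matrix into multiplication by a symmetric Jacobi matrix. *)
Definition leg_seq (f : R -> C) (n : nat) : C :=
  Cmult (Cmult (Cpow (- Ci) n) (RtoC (sqrt (2 * INR n + 1)))) (clcoef f n).

Lemma Cmod2 (z : C) : Cmod z ^ 2 = fst z ^ 2 + snd z ^ 2.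
Proof. unfold Cmod; apply pow2_sqrt; nra. Qed.

Lemma Cmod_leg_seq (f : R -> C) (n : nat) :
  Cmod (leg_seq f n) ^ 2 =
  (2 * INR n + 1) * lcoef (fun x => fst (f x)) n ^ 2
  + (2 * INR n + 1) * lcoef (fun x => snd (f x)) n ^ 2.
Proof.
unfold leg_seq; rewrite !Cmod_mult, !Rpow_mult_distr.
assert (E : Cmod (Cpow (- Ci) n) = 1).
{ assert (E1 : Cmod (- Ci) = 1).
  { rewrite Cmod_opp; unfold Cmod, Ci; simpl.
    transitivity (sqrt 1); [f_equal; ring | apply sqrt_1]. }
  induction n as [| n IH]; simpl; [apply Cmod_1 |].
  rewrite Cmod_mult, IH, E1; ring. }
rewrite E, Cmod_R, Cmod2; pose proof (pos_INR n).
rewrite pow2_abs, pow2_sqrt by lra.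
unfold clcoef; simpl fst; simpl snd; ring.
Qed.

Lemma sum_leg_seq_le (f : R -> C) (N : nat) : ccts f ->
  sum_n (fun n => Cmod (leg_seq f n) ^ 2) N <= 2 * Int (fun x => Cmod (f x) ^ 2).
Proof.
intros [H1 H2].
rewrite (sum_n_ext _ _ _ (Cmod_leg_seq f)), (sum_n_plus (G := R_AbelianGroup)).
change plus with Rplus; cbv beta.
rewrite (Int_ext _ (fun x => 1 * fst (f x) ^ 2 + 1 * snd (f x) ^ 2))
  by (intros; rewrite Cmod2; ring).
rewrite Int_lin by auto with cts.
eapply Rle_trans;
  [exact (Rplus_le_compat _ _ _ _ (bessel _ N H1) (bessel _ N H2)) | cbv beta; lra].
Qed.

Lemma leg_seq_summable (f : R -> C) : ccts f -> square_summable (leg_seq f).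
Proof.
intros Hf.
destruct (ex_finite_lim_seq_incr (sum_n (fun n => Cmod (leg_seq f n) ^ 2))
  (2 * Int (fun x => Cmod (f x) ^ 2))) as [L HL].
- intros n; rewrite sum_Sn; change plus with Rplus; cbv beta.
  pose proof (pow2_ge_0 (Cmod (leg_seq f (S n)))); lra.
- intros n; now apply sum_leg_seq_le.
- exists L; exact HL.
Qed.

Definition leg_vec (f : R -> C) (Hf : ccts f) : l2 :=
  mk_l2 (leg_seq f) (leg_seq_summable f Hf).

(** The factor 2 comes from normalising with sqrt(2n+1) where orthonormality would ask for
    sqrt((2n+1)/2). *)
Lemma leg_vec_norm (f : R -> C) (Hf : ccts f) :
  l2_norm (leg_vec f Hf) ^ 2 <= 2 * Int (fun x => Cmod (f x) ^ 2).
Proof.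
rewrite l2_norm_sq.
pose proof (Series_correct _ (l2_summable (leg_vec f Hf))) as H.
exact (is_lim_seq_le _ (fun _ => 2 * Int (fun x => Cmod (f x) ^ 2))
  (Finite (Series (fun n => Cmod (leg_seq f n) ^ 2)))
  (Finite (2 * Int (fun x => Cmod (f x) ^ 2)))
  (fun N => sum_leg_seq_le f N Hf) H (is_lim_seq_const _)).
Qed.

(** Allows rewriting under [leg_vec] although the continuity proof is one of its arguments. *)
Lemma leg_vec_ext (f g : R -> C) (Hf : ccts f) (Hg : ccts g) :
  (forall x, f x = g x) -> leg_vec f Hf = leg_vec g Hg.
Proof.
intros H; apply l2_ext; intros n; simpl; unfold leg_seq, clcoef, lcoef.
now do 2 f_equal; apply Int_ext; intros x; rewrite H.
Qed.

Lemma ccts_lin (c : C) (f g : R -> C) : ccts f -> ccts g ->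
  ccts (fun x => Cplus (Cmult c (f x)) (g x)).
Proof. intros [? ?] [? ?]; split; simpl; auto with cts. Qed.

Lemma leg_vec_lin (c : C) (f g : R -> C) (Hf : ccts f) (Hg : ccts g)
    (H : ccts (fun x => Cplus (Cmult c (f x)) (g x))) :
  leg_vec _ H = l2_plus (l2_scal c (leg_vec f Hf)) (leg_vec g Hg).
Proof.
apply l2_ext; intros n; simpl; unfold leg_seq.
enough (E : clcoef (fun x => Cplus (Cmult c (f x)) (g x)) n
            = Cplus (Cmult c (clcoef f n)) (clcoef g n)) by (rewrite E; ring).
destruct Hf, Hg; unfold clcoef, lcoef, Cplus, Cmult; simpl; f_equal.
- rewrite (Int_ext _ (fun x => fst c * (fst (f x) * leg n x)
    + 1 * (- snd c * (snd (f x) * leg n x) + 1 * (fst (g x) * leg n x)))) by (intros; ring).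
  rewrite !Int_lin by auto with cts; ring.
- rewrite (Int_ext _ (fun x => fst c * (snd (f x) * leg n x)
    + 1 * (snd c * (fst (f x) * leg n x) + 1 * (snd (g x) * leg n x)))) by (intros; ring).
  rewrite !Int_lin by auto with cts; ring.
Qed.

(** * Legendre coefficients of a derivative and the action of J_t *)

Definition cderiv (f df : R -> C) : Prop :=
  (forall x : R, is_derive (fun y : R => fst (f y)) x (fst (df x))) /\
  (forall x : R, is_derive (fun y : R => snd (f y)) x (snd (df x))).

Lemma cderiv_ccts (f df : R -> C) : cderiv f df -> ccts f.
Proof.
intros [H1 H2]; split;
  [exact (cts_derive _ _ H1) | exact (cts_derive _ _ H2)].
Qed.

(** Integration by parts against P_n - P_{n+2}: this vanishes at both endpoints, and [dleg_diff]
    identifies its derivative. *)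
Lemma lcoef_derive_S (u du : R -> R) (n : nat) :
  (forall x : R, is_derive u x (du x)) -> cts du ->
  (2 * INR n + 3) * lcoef u (S n) = lcoef du n - lcoef du (S (S n)).
Proof.
intros H Hdu; pose proof (cts_derive _ _ H) as Hu; unfold lcoef.
rewrite (Int_by_parts u (leg n) du (dleg n)), (Int_by_parts u (leg (S (S n))) du (dleg (S (S n))));
  auto with cts; try apply is_derive_leg.
rewrite !leg_1, leg_SS_opp1, <- Int_scal by auto with cts.
rewrite (Int_ext _ (fun x => 1 * (u x * dleg (S (S n)) x) + (-1) * (u x * dleg n x))).
- rewrite Int_lin by auto with cts; ring.
- intros x.
  replace ((2 * INR n + 3) * (u x * leg (S n) x)) with (u x * ((2 * INR n + 3) * leg (S n) x)) by ring.
  rewrite <- dleg_diff; ring.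
Qed.

Lemma lcoef_derive_0 (u du : R -> R) :
  (forall x : R, is_derive u x (du x)) -> cts du -> lcoef du 0 = u 1 - u (-1).
Proof.
intros H Hdu; unfold lcoef.
rewrite (Int_ext _ du) by (intros; simpl; ring); now apply Int_derive.
Qed.

Lemma lcoef_derive_1 (u du : R -> R) :
  (forall x : R, is_derive u x (du x)) -> cts du ->
  lcoef du 1 = u 1 + u (-1) - lcoef u 0.
Proof.
intros H Hdu; unfold lcoef.
rewrite (Int_by_parts u (leg 1) du (dleg 1)); auto with cts; [| apply is_derive_leg].
simpl; ring.
Qed.

(** The denominator splits into the normalising factors of the two neighbouring coordinates of
    [leg_seq], so that they cancel in the matrix product. *)
Lemma Jt_offdiag_sqrt (l : R) (n : nat) :
  Jt_offdiag l n = Cdiv (RtoC l)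
    (Cmult (RtoC (sqrt (2 * INR n + 1))) (RtoC (sqrt (2 * INR (S n) + 1)))).
Proof.
unfold Jt_offdiag; pose proof (pos_INR n).
rewrite <- RtoC_mult, <- RtoC_div.
- rewrite <- sqrt_mult_alt by lra; do 3 f_equal; rewrite S_INR; ring.
- rewrite S_INR; apply Rgt_not_eq, Rmult_lt_0_compat; apply sqrt_lt_R0; lra.
Qed.

Definition boundary_form (l : R) (t : C) (f : R -> C) : C :=
  Cminus (Cmult (t - Ci * RtoC l) (f 1)) (Cmult (t + Ci * RtoC l) (f (-1))).

Definition unit_seq (k n : nat) : C := if Nat.eqb n k then RtoC 1 else RtoC 0.

Lemma Ci2 : Cmult Ci Ci = Copp (RtoC 1).
Proof. unfold Ci, Cmult, Copp, RtoC; simpl; f_equal; ring. Qed.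

Lemma clcoef_derive_0 (f df : R -> C) : cderiv f df -> ccts df ->
  clcoef df 0 = Cminus (f 1) (f (-1)).
Proof.
intros [D1 D2] [C1 C2]; unfold clcoef.
now rewrite (lcoef_derive_0 _ _ D1 C1), (lcoef_derive_0 _ _ D2 C2).
Qed.

(** Later shows that an exponential taking different values at 1 and -1 has a nonzero image in
    l2. *)
Lemma leg_seq_derive_0 (f df : R -> C) : cderiv f df -> ccts df ->
  leg_seq df 0 = Cminus (f 1) (f (-1)).
Proof.
intros D H; unfold leg_seq; rewrite (clcoef_derive_0 f df D H).
replace (sqrt (2 * INR 0 + 1)) with 1; [simpl; ring |].
transitivity (sqrt 1); [symmetry; apply sqrt_1 | f_equal; simpl; ring].
Qed.

(** Endpoint values enter row 0 alone, through the coefficients 0 and 1 of [df], which involve f(1)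
    - f(-1) and f(1) + f(-1). In every later row [lcoef_derive_S] applies and leaves no boundary
    term. *)
Lemma Jt_leg_seq_derive (l : R) (t : C) (f df : R -> C) (n : nat) :
  cderiv f df -> ccts df ->
  jacobi_apply (Jt_offdiag l) (Jt_diag t) (leg_seq df) n =
  Cplus (Cmult (Cmult Ci (RtoC l)) (leg_seq f n)) (Cmult (boundary_form l t f) (unit_seq 0 n)).
Proof.
intros [D1 D2] [C1 C2].
assert (sq : forall n, RtoC (sqrt (2 * INR n + 1)) <> RtoC 0).
{ intros k E; apply (f_equal fst) in E; simpl in E; pose proof (pos_INR k).
  apply sqrt_eq_0 in E; lra. }
destruct n as [| n].
- rewrite jacobi_apply_0, Jt_offdiag_sqrt; unfold leg_seq.
  pose proof (clcoef_derive_0 f df (conj D1 D2) (conj C1 C2)) as E0.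
  assert (E1 : clcoef df 1 = Cminus (Cplus (f 1) (f (-1))) (clcoef f 0)).
  { unfold clcoef; rewrite (lcoef_derive_1 _ _ D1 C1), (lcoef_derive_1 _ _ D2 C2).
    reflexivity. }
  rewrite E0, E1; pose proof (sq 1%nat) as Q1.
  assert (S0 : RtoC (sqrt (2 * INR 0 + 1)) = RtoC 1).
  { f_equal; transitivity (sqrt 1); [f_equal; simpl; ring | apply sqrt_1]. }
  rewrite S0; simpl Cpow; simpl Jt_diag; unfold boundary_form, unit_seq; simpl Nat.eqb; cbv iota.
  field; exact Q1.
- rewrite jacobi_apply_S, !Jt_offdiag_sqrt; unfold leg_seq.
  assert (E : Cmult (RtoC (2 * INR n + 3)) (clcoef f (S n))
              = Cminus (clcoef df n) (clcoef df (S (S n)))).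
  { pose proof (lcoef_derive_S _ _ n D1 C1) as F1.
    pose proof (lcoef_derive_S _ _ n D2 C2) as F2.
    apply injective_projections; unfold clcoef, Cmult, Cminus, Cplus, Copp, RtoC;
      simpl fst; simpl snd; lra. }
  assert (Q : RtoC (2 * INR n + 3) = Cmult (RtoC (sqrt (2 * INR (S n) + 1)))
                                          (RtoC (sqrt (2 * INR (S n) + 1)))).
  { rewrite <- RtoC_mult, sqrt_sqrt; pose proof (pos_INR n);
      rewrite S_INR; [f_equal; ring | lra]. }
  rewrite Q in E.
  pose proof (sq n) as Q0; pose proof (sq (S n)) as Q1; pose proof (sq (S (S n))) as Q2.
  set (s0 := RtoC (sqrt (2 * INR n + 1))) in *.
  set (s1 := RtoC (sqrt (2 * INR (S n) + 1))) in *.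
  set (s2 := RtoC (sqrt (2 * INR (S (S n)) + 1))) in *.
  set (P := Cpow (- Ci) n) in *.
  assert (E2 : clcoef df n = Cplus (clcoef df (S (S n))) (Cmult (Cmult s1 s1) (clcoef f (S n)))).
  { rewrite E; ring. }
  simpl Cpow; fold P; rewrite E2; simpl Jt_diag; unfold unit_seq; simpl Nat.eqb; cbv iota.
  set (d2 := clcoef df (S (S n))); set (d1 := clcoef df (S n)); set (f1 := clcoef f (S n)).
  (* To [field], [Ci] is an indeterminate, so its square is replaced by hand on both sides. *)
  replace (Cmult (- Ci) (Cmult (- Ci) P)) with (Copp P).
  2:{ replace (Cmult (- Ci) (Cmult (- Ci) P)) with (Cmult (Cmult Ci Ci) P) by ring.
      rewrite Ci2; ring. }
  replace (Cmult (Cmult Ci (RtoC l)) (Cmult (Cmult (Cmult (- Ci) P) s1) f1))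
    with (Copp (Cmult (Cmult Ci Ci) (Cmult (RtoC l) (Cmult (Cmult P s1) f1)))) by ring.
  rewrite Ci2.
  field; auto.
Qed.

(** * Approximating the identity function by trigonometric polynomials *)

(** The half angle makes [hcos] nonnegative on [-1, 1], with zeros at the endpoints. Both functions
    change sign under x -> x + 2, so a product of an even number of them has period 2. *)
Definition hsin (x : R) : R := sin (PI / 2 * x).
Definition hcos (x : R) : R := cos (PI / 2 * x).

Lemma is_derive_hsin (x : R) : is_derive hsin x (PI / 2 * hcos x).
Proof. unfold hsin, hcos; auto_derive; [trivial | ring]. Qed.

Lemma is_derive_hcos (x : R) : is_derive hcos x (- (PI / 2) * hsin x).
Proof. unfold hsin, hcos; auto_derive; [trivial | ring]. Qed.

Lemma hcos2 (x : R) : hcos x ^ 2 = 1 - hsin x ^ 2.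
Proof. unfold hsin, hcos; pose proof (sin2_cos2 (PI / 2 * x)); unfold Rsqr in *; lra. Qed.

Lemma cts_hsin : cts hsin.
Proof. exact (cts_derive _ _ is_derive_hsin). Qed.

Lemma cts_hcos : cts hcos.
Proof. exact (cts_derive _ _ is_derive_hcos). Qed.
#[global] Hint Resolve cts_hsin cts_hcos : cts.

(* The mean value of [hsin ^ (2 * n)]. *)
Fixpoint wallis (n : nat) : R :=
  match n with
  | O => 1
  | S k => wallis k * ((2 * INR k + 1) / (2 * INR k + 2))
  end.

Lemma wallis_pos (n : nat) : 0 < wallis n.
Proof.
induction n as [| n IH]; simpl; [lra |]; pose proof (pos_INR n).
apply Rmult_lt_0_compat; [easy | apply Rdiv_lt_0_compat; lra].
Qed.

(* [saw n] is [x] minus a trigonometric polynomial of period 2; its derivative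
   is a normalised power of [hsin ^ 2], which concentrates at the odd integers. *)
Fixpoint saw (n : nat) (x : R) : R :=
  match n with
  | O => x
  | S k => saw k x - / (PI / 2 * (2 * INR k + 2) * wallis (S k))
                     * (hsin x ^ (2 * k) * (hsin x * hcos x))
  end.

Definition dsaw (n : nat) (x : R) : R := / wallis n * hsin x ^ (2 * n).

Lemma cts_dsaw (n : nat) : cts (dsaw n).
Proof. unfold dsaw; auto with cts. Qed.

(** The derivative of s^(2n+1) c, with s and c for [hsin] and [hcos], combines s^(2n) and s^(2n+2).
    The coefficient in [saw] cancels the lower power, and the ratio in [wallis] then normalises the
    higher one. *)
Lemma is_derive_saw (n : nat) (x : R) : is_derive (saw n) x (dsaw n x).
Proof.
induction n as [| n IH].
- unfold dsaw; simpl; rewrite Rinv_1, Rmult_1_r; apply (is_derive_id (K := R_AbsRing)).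
- pose proof (pos_INR n); pose proof (wallis_pos n); pose proof PI_RGT_0.
  set (g := / (PI / 2 * (2 * INR n + 2) * wallis (S n))).
  assert (D : is_derive (fun y => hsin y ^ (2 * n) * (hsin y * hcos y)) x
    (PI / 2 * hsin x ^ (2 * n) * ((2 * INR n + 1) - (2 * INR n + 2) * hsin x ^ 2))).
  { apply (is_derive_ext (fun y => hsin y ^ S (2 * n) * hcos y)).
    { intros y; simpl; ring. }
    replace (PI / 2 * hsin x ^ (2 * n) * (2 * INR n + 1 - (2 * INR n + 2) * hsin x ^ 2))
      with ((INR (S (2 * n)) * (PI / 2 * hcos x) * hsin x ^ Init.Nat.pred (S (2 * n))) * hcos x
            + hsin x ^ S (2 * n) * (- (PI / 2) * hsin x)).
    - apply (is_derive_mult (K := R_AbsRing) (fun y => hsin y ^ S (2 * n)) hcos);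
        [apply is_derive_pow, is_derive_hsin | apply is_derive_hcos | intros; apply Rmult_comm].
    - rewrite S_INR, mult_INR; simpl Init.Nat.pred; simpl INR.
      replace (INR n + 0) with (INR n) by ring.
      transitivity (PI / 2 * hsin x ^ (2 * n) * ((2 * INR n + 1) * hcos x ^ 2 - hsin x ^ 2)).
      + simpl; ring.
      + rewrite hcos2; ring. }
  replace (dsaw (S n) x) with (dsaw n x - g *
    (PI / 2 * hsin x ^ (2 * n) * ((2 * INR n + 1) - (2 * INR n + 2) * hsin x ^ 2))).
  + apply (is_derive_minus (V := R_NormedModule) (saw n)); [exact IH |].
    now apply is_derive_scal.
  + unfold dsaw, g; replace (2 * S n)%nat with (2 + 2 * n)%nat by lia.
    rewrite pow_add; simpl wallis; field; lra.
Qed.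

Lemma cts_saw (n : nat) : cts (saw n).
Proof. exact (cts_derive _ _ (is_derive_saw n)). Qed.
#[global] Hint Resolve cts_saw cts_dsaw : cts.

Lemma hcos_1 : hcos 1 = 0.
Proof. unfold hcos; rewrite Rmult_1_r; apply cos_PI2. Qed.

Lemma hcos_opp1 : hcos (-1) = 0.
Proof.
unfold hcos; replace (PI / 2 * -1) with (- (PI / 2)) by ring.
rewrite cos_neg; apply cos_PI2.
Qed.

Lemma saw_fixed (n : nat) (x : R) : hsin x * hcos x = 0 -> saw n x = x.
Proof.
intros H; induction n as [| n IH]; simpl; [reflexivity |].
rewrite H, IH; ring.
Qed.

Lemma hcos_ge0 (x : R) : -1 <= x <= 1 -> 0 <= hcos x.
Proof. intros Hx; pose proof PI_RGT_0; apply cos_ge_0; nra. Qed.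

Lemma hsin_sign (x : R) : -1 <= x <= 1 -> 0 <= x * hsin x.
Proof.
assert (P : forall y, 0 <= y <= 1 -> 0 <= hsin y).
{ intros y Hy; pose proof PI_RGT_0; apply sin_ge_0; nra. }
intros Hx; destruct (Rle_dec 0 x) as [H | H].
- apply Rmult_le_pos; [easy | apply P; lra].
- replace (x * hsin x) with ((- x) * hsin (- x)).
  + apply Rmult_le_pos; [lra | apply P; lra].
  + unfold hsin; replace (PI / 2 * - x) with (- (PI / 2 * x)) by ring.
    rewrite sin_neg; ring.
Qed.

Lemma pow_even_ge0 (y : R) (n : nat) : 0 <= y ^ (2 * n).
Proof. rewrite pow_mult; apply pow_le, pow2_ge_0. Qed.

(** On [-1, 1] each subtracted term has the sign of [x], so it can only lower [x * saw n x]. *)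
Lemma saw_le (n : nat) (x : R) : -1 <= x <= 1 -> x * saw n x <= x * x.
Proof.
intros Hx; induction n as [| n IH]; simpl saw; [lra |].
pose proof (hsin_sign x Hx); pose proof (hcos_ge0 x Hx).
pose proof (pos_INR n); pose proof (wallis_pos (S n)); pose proof PI_RGT_0.
set (g := / (PI / 2 * (2 * INR n + 2) * wallis (S n))).
assert (0 < g).
{ apply Rinv_0_lt_compat, Rmult_lt_0_compat; [| easy].
  apply Rmult_lt_0_compat; lra. }
assert (0 <= g * (hsin x ^ (2 * n) * ((x * hsin x) * hcos x))).
{ apply Rmult_le_pos; [lra |].
  apply Rmult_le_pos; [apply pow_even_ge0 | now apply Rmult_le_pos]. }
change (x * (saw n x - g * (hsin x ^ (2 * n) * (hsin x * hcos x))) <= x * x).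
clearbody g.
replace (x * (saw n x - g * (hsin x ^ (2 * n) * (hsin x * hcos x)))) with
  (x * saw n x - g * (hsin x ^ (2 * n) * ((x * hsin x) * hcos x))) by ring.
lra.
Qed.

(** [saw n] vanishes at 0 and has a nonnegative derivative. *)
Lemma saw_sign (n : nat) (x : R) : 0 <= x * saw n x.
Proof.
destruct (MVT_gen (saw n) 0 x (dsaw n)) as [c [_ Hc]].
- intros; apply is_derive_saw.
- intros; apply continuity_pt_filterlim, cts_saw.
- rewrite (saw_fixed n 0) in Hc.
  + replace (saw n x) with (dsaw n c * x) by lra.
    replace (x * (dsaw n c * x)) with (dsaw n c * (x * x)) by ring.
    apply Rmult_le_pos; [| nra].
    apply Rmult_le_pos; [left; apply Rinv_0_lt_compat, wallis_pos |].
    apply pow_even_ge0.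
  + unfold hsin; rewrite Rmult_0_r, sin_0; ring.
Qed.

(** By the two preceding lemmas [saw n x] lies between 0 and [x]. This bounds the square by an
    expression linear in [saw n], fit for integration by parts. *)
Lemma saw_sq_le (n : nat) (x : R) : -1 <= x <= 1 -> saw n x ^ 2 <= x * saw n x.
Proof.
intros Hx; pose proof (saw_le n x Hx); pose proof (saw_sign n x).
destruct (Req_dec x 0) as [-> | N].
- rewrite saw_fixed; [lra |]; unfold hsin; rewrite Rmult_0_r, sin_0; ring.
- apply Rmult_le_reg_l with (x * x); [nra |].
  nra.
Qed.

Lemma Int_dsaw (n : nat) : Int (dsaw n) = 2.
Proof.
rewrite (Int_derive (saw n) (dsaw n) (is_derive_saw n)) by auto with cts.
rewrite !saw_fixed by (rewrite ?hcos_1, ?hcos_opp1; ring); ring.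
Qed.

(** Measures how [dsaw n], of constant mass 2, concentrates at the zeros 1 and -1 of [hcos]. As
    [hcos ^ 2] is [1 - hsin ^ 2], the integrand combines [dsaw n] and [dsaw (S n)]. *)
Lemma Int_dsaw_hcos (n : nat) :
  Int (fun x => hcos x ^ 2 * dsaw n x) = / (INR n + 1).
Proof.
pose proof (pos_INR n); pose proof (wallis_pos n).
rewrite (Int_ext _ (fun x => 1 * dsaw n x
  + - ((2 * INR n + 1) / (2 * INR n + 2)) * dsaw (S n) x)).
- rewrite Int_lin, !Int_dsaw by auto with cts; field; lra.
- intros x; rewrite hcos2; unfold dsaw; replace (2 * S n)%nat with (2 + 2 * n)%nat by lia.
  rewrite pow_add; simpl wallis; field; lra.
Qed.

Lemma hcos_lower (x : R) : -1 <= x <= 1 -> 1 - x ^ 2 <= 6 * hcos x.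
Proof.
assert (P : forall y, 0 <= y <= 1 -> 1 - y ^ 2 <= 6 * hcos y).
{ intros y Hy; pose proof PI_4; pose proof PI2_1.
  set (v := PI / 2 * (1 - y)).
  assert (E : hcos y = sin v).
  { unfold hcos, v; rewrite <- sin_shift; f_equal; ring. }
  assert (Hv : 0 <= v <= 2) by (unfold v; nra).
  assert (Hv1 : 1 - y <= v) by (unfold v; nra).
  destruct (sin_bound v 0) as [L _]; [lra | unfold v; nra |].
  assert (L' : v - v ^ 3 / 6 <= sin v).
  { eapply Rle_trans; [| exact L]; right.
    unfold sin_approx, sin_term; simpl; field. }
  rewrite E; nra. }
intros Hx; destruct (Rle_dec 0 x) as [H | H]; [apply P; lra |].
replace (hcos x) with (hcos (- x)).
- replace (x ^ 2) with ((- x) ^ 2) by ring; apply P; lra.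
- unfold hcos; replace (PI / 2 * - x) with (- (PI / 2 * x)) by ring; apply cos_neg.
Qed.

(** Integration by parts bounds the left side by the integral of (1 - x^2)/2 against [dsaw n]. Here
    (1 - x^2)/2 <= 3 hcos x <= d + (3/d) (hcos x)^2, and both resulting integrals are known. *)
Lemma Int_saw_le (n : nat) (d : R) : 0 < d ->
  Int (fun x => saw n x ^ 2) <= 2 * d + 3 / (d * (INR n + 1)).
Proof.
intros Hd; pose proof (pos_INR n).
apply Rle_trans with (Int (fun x => x * saw n x)).
{ apply Int_le; auto with cts; intros; now apply saw_sq_le. }
(* This antiderivative of [x] vanishes at 1 and -1, so no boundary terms survive. *)
rewrite (Int_by_parts (fun x => / 2 * (x ^ 2 - 1)) (saw n) (fun x => x) (dsaw n));
  auto with cts.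
3: apply is_derive_saw.
2: intros x; auto_derive; [trivial | field].
apply Rle_trans with (Int (fun x => (-1) * (/ 2 * (x ^ 2 - 1) * dsaw n x))).
{ rewrite Int_scal by auto 6 with cts; lra. }
replace (2 * d + 3 / (d * (INR n + 1))) with
  (Int (fun x => d * dsaw n x + 3 / d * (hcos x ^ 2 * dsaw n x))).
2:{ rewrite Int_lin, Int_dsaw, Int_dsaw_hcos by auto with cts; field; lra. }
apply Int_le; auto 6 with cts.
intros x Hx.
assert (0 <= dsaw n x).
{ apply Rmult_le_pos; [left; apply Rinv_0_lt_compat, wallis_pos | apply pow_even_ge0]. }
pose proof (hcos_lower x Hx) as L; pose proof (hcos_ge0 x Hx).
(* AM-GM: [3 c <= d + 3 c ^ 2 / d] *)
assert (A : 3 * hcos x <= d + 3 / d * hcos x ^ 2).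
{ apply Rmult_le_reg_l with d; [easy |].
  replace (d * (d + 3 / d * hcos x ^ 2)) with (d ^ 2 + 3 * hcos x ^ 2) by (field; lra).
  pose proof (pow2_ge_0 (d - 3 / 2 * hcos x)); pose proof (pow2_ge_0 (hcos x)); lra. }
replace (-1 * (/ 2 * (x ^ 2 - 1) * dsaw n x)) with (/ 2 * (1 - x ^ 2) * dsaw n x) by field.
replace (d * dsaw n x + 3 / d * (hcos x ^ 2 * dsaw n x))
  with ((d + 3 / d * hcos x ^ 2) * dsaw n x) by ring.
apply Rmult_le_compat_r; lra.
Qed.

Lemma Int_saw_small (eps : R) : 0 < eps -> exists n, Int (fun x => saw n x ^ 2) < eps.
Proof.
intros He.
(* With d = eps/4 the bound is eps/2 + 12/(eps (n+1)), and n > 24/eps^2 makes the second summand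
   smaller than eps/2. *)
destruct (INR_archimed 1 (24 / eps ^ 2)) as [n Hn]; [lra |].
exists n; pose proof (pos_INR n).
eapply Rle_lt_trans; [apply (Int_saw_le n (eps / 4)); lra |].
apply Rmult_lt_reg_r with (INR n + 1); [lra |].
assert (A : 24 < eps ^ 2 * (INR n + 1)).
{ apply Rmult_lt_reg_r with (/ eps ^ 2); [apply Rinv_0_lt_compat; nra |].
  replace (eps ^ 2 * (INR n + 1) * / eps ^ 2) with (INR n + 1) by (field; lra).
  unfold Rdiv in Hn; lra. }
apply Rmult_lt_reg_l with eps; [easy |].
replace (eps * ((2 * (eps / 4) + 3 / (eps / 4 * (INR n + 1))) * (INR n + 1)))
  with (eps ^ 2 * (INR n + 1) / 2 + 12) by (field; lra).
lra.
Qed.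

(** * Exponential eigenfunctions *)

Definition expo (k : C) (x : R) : C :=
  (exp (fst k * x) * cos (snd k * x), exp (fst k * x) * sin (snd k * x)).

Lemma expo_cderiv (k : C) : cderiv (expo k) (fun x => Cmult k (expo k x)).
Proof. split; intros x; simpl; auto_derive; auto; ring. Qed.

Lemma expo_plus (k k' : C) (x : R) : expo (k + k') x = Cmult (expo k x) (expo k' x).
Proof.
unfold expo, Cmult, Cplus; simpl.
rewrite !Rmult_plus_distr_r, exp_plus, cos_plus, sin_plus; f_equal; ring.
Qed.

Lemma expo_plus_arg (k : C) (x y : R) : expo k (x + y) = Cmult (expo k x) (expo k y).
Proof.
unfold expo, Cmult; simpl.
rewrite !Rmult_plus_distr_l, exp_plus, cos_plus, sin_plus; f_equal; ring.
Qed.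

Lemma Cmod_expo2 (k : C) (x : R) : Cmod (expo k x) ^ 2 = exp (2 * fst k * x).
Proof.
rewrite Cmod2; unfold expo; simpl fst; simpl snd.
pose proof (sin2_cos2 (snd k * x)) as T; unfold Rsqr in T.
replace (2 * fst k * x) with (fst k * x + fst k * x) by ring; rewrite exp_plus.
replace (_ + _) with (exp (fst k * x) * exp (fst k * x) *
  (sin (snd k * x) * sin (snd k * x) + cos (snd k * x) * cos (snd k * x))) by ring.
rewrite T; ring.
Qed.

Lemma expo_neq0 (k : C) (x : R) : expo k x <> RtoC 0.
Proof.
intros H; pose proof (Cmod_expo2 k x) as E; rewrite H, Cmod_0 in E.
pose proof (exp_pos (2 * fst k * x)); simpl in E; lra.
Qed.

(** A complex logarithm from the polar form; the angle is an arccosine whose sign is that of the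
    imaginary part. *)
Lemma expo_surj (z : C) : z <> RtoC 0 -> exists k, expo k 1 = z.
Proof.
intros Hz; pose proof (Cmod_gt_0 z) as [P _]; specialize (P Hz).
pose proof (Cmod2 z) as E; set (r := Cmod z) in *.
assert (E1 : (fst z / r) ^ 2 + (snd z / r) ^ 2 = 1).
{ transitivity ((fst z ^ 2 + snd z ^ 2) / r ^ 2); [field; lra |].
  rewrite <- E; field; lra. }
assert (B : -1 <= fst z / r <= 1) by (pose proof (pow2_ge_0 (snd z / r)); nra).
assert (A : exists th, cos th = fst z / r /\ sin th = snd z / r).
{ assert (S : sin (acos (fst z / r)) = Rabs (snd z / r)).
  { rewrite sin_acos by exact B; unfold Rsqr.
    replace (1 - fst z / r * (fst z / r)) with (Rsqr (snd z / r)) by (unfold Rsqr; lra).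
    apply sqrt_Rsqr_abs. }
  destruct (Rle_dec 0 (snd z / r)) as [H | H].
  - exists (acos (fst z / r)); rewrite S, cos_acos, Rabs_pos_eq by easy; auto.
  - exists (- acos (fst z / r)); rewrite cos_neg, sin_neg, S, cos_acos, Rabs_left by lra.
    split; ring. }
destruct A as [th [A1 A2]]; exists (ln r, th); unfold expo; simpl.
rewrite !Rmult_1_r, exp_ln, A1, A2 by exact P.
destruct z as [a b]; simpl; f_equal; field; lra.
Qed.

(** After division by exp(-k) the condition reads exp(2k) = (t + il)/(t - il). This is a nonzero
    complex number, so it has a logarithm [w], and k = w/2. *)
Lemma boundary_form_solvable (l : R) (t : C) :
  Cminus t (Ci * RtoC l) <> RtoC 0 -> Cplus t (Ci * RtoC l) <> RtoC 0 ->
  exists k, boundary_form l t (expo k) = RtoC 0.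
Proof.
intros H1 H2.
destruct (expo_surj (Cdiv (t + Ci * RtoC l) (t - Ci * RtoC l))) as [w Hw].
{ intros E; apply H2; rewrite <- (Cmult_0_l (t - Ci * RtoC l)), <- E; now field. }
exists (fst w / 2, snd w / 2); unfold boundary_form.
set (k := (fst w / 2, snd w / 2)).
assert (E : expo k 2 = expo w 1).
{ unfold expo, k; simpl; now replace (fst w / 2 * 2) with (fst w * 1) by field;
    replace (snd w / 2 * 2) with (snd w * 1) by field. }
replace (expo k 1) with (Cmult (expo k (-1)) (expo k 2)).
- rewrite E, Hw; now field.
- rewrite <- expo_plus_arg; f_equal; ring.
Qed.

Definition ipi : C := (0, PI).

(** exp(i pi s x) equals -1 at both endpoints. Hence a shift of [k] by i pi or -i pi preserves the
    zeros of the boundary form. *)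
Lemma boundary_form_shift (l : R) (t k : C) (s : R) : s = 1 \/ s = -1 ->
  boundary_form l t (expo (k + RtoC s * ipi)) = Copp (boundary_form l t (expo k)).
Proof.
intros Hs; unfold boundary_form; rewrite !expo_plus.
assert (E : forall x, x = 1 \/ x = -1 -> expo (RtoC s * ipi) x = Copp (RtoC 1)).
{ intros x Hx; unfold expo, ipi, Cmult, RtoC, Copp; simpl.
  replace ((s * 0 - 0 * PI) * x) with 0 by ring; rewrite exp_0.
  assert (A : (s * PI + 0 * 0) * x = PI \/ (s * PI + 0 * 0) * x = - PI).
  { destruct Hs, Hx; subst; [left | right | right | left]; ring. }
  destruct A as [-> | ->]; rewrite ?cos_neg, ?sin_neg, cos_PI, sin_PI; f_equal; ring. }
rewrite !E by auto; ring.
Qed.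

(** * Linear spans *)

Section Span.

Context {H : NormedModule C_AbsRing}.
Implicit Types (S : H -> Prop) (T : H -> H).

Lemma span_incl S v : S v -> linear_span S v.
Proof.
intros Hv; replace v with (plus (scal (RtoC 1) v) zero).
- apply span_add; [exact Hv | apply span_zero].
- rewrite plus_zero_r; exact (scal_one v).
Qed.

Lemma span_plus S x y : linear_span S x -> linear_span S y -> linear_span S (plus x y).
Proof.
intros Hx Hy; induction Hx as [| c v z Hv Hz IH].
- now rewrite plus_zero_l.
- rewrite <- plus_assoc; now apply span_add.
Qed.

Lemma span_scal S (c : C_AbsRing) x : linear_span S x -> linear_span S (scal c x).
Proof.
intros Hx; induction Hx as [| d v z Hv Hz IH].
- replace (@scal C_AbsRing H c (@zero H)) with (@zero H);
    [apply span_zero | symmetry; exact (@scal_zero_r C_AbsRing H c)].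
- rewrite scal_distr_l, scal_assoc; now apply span_add.
Qed.

Lemma closed_span_incl S x : linear_span S x -> closed_linear_span S x.
Proof. intros Hx eps; exists x; split; [exact Hx | apply ball_center]. Qed.

Lemma span_eigen_invariant T : is_linear (U := H) (V := H) T ->
  forall x, linear_span (eigenvector T) x -> linear_span (eigenvector T) (T x).
Proof.
intros L x Hx; induction Hx as [| c v z Hv Hz IH].
- rewrite linear_zero by exact L; apply span_zero.
- refine (eq_ind_r (linear_span (eigenvector T)) _ (linear_plus T L (scal c v) z)).
  apply span_plus; [| exact IH].
  refine (eq_ind_r (linear_span (eigenvector T)) _ (linear_scal T L c v)).
  pose proof Hv as [_ [lam E]]; rewrite E.
  apply span_scal, span_scal; now apply span_incl.
Qed.

End Span.

(** * The closed span of the eigenvectors in l2 *)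

Definition eigen_span (T : l2 -> l2) : l2 -> Prop :=
  closed_linear_span (H := l2_NormedModule) (eigenvector (H := l2_NormedModule) T).

Lemma eigen_span_closed (T : l2 -> l2) (x : l2) :
  (forall eps, 0 < eps -> exists y, eigen_span T y /\ l2_norm (minus y x) < eps) -> eigen_span T x.
Proof.
intros Hx eps; pose proof (cond_pos eps).
destruct (Hx (eps / 2)) as [y [Hy1 Hy2]]; [lra |].
assert (P : 0 < eps / 2) by lra.
destruct (Hy1 (mkposreal _ P)) as [z [Hz1 Hz2]]; exists z; split; [exact Hz1 |].
replace (pos eps) with (eps / 2 + eps / 2) by field.
exact (l2_ball_triangle x y z _ _ Hy2 Hz2).
Qed.

Lemma eigen_span_plus (T : l2 -> l2) (x y : l2) :
  eigen_span T x -> eigen_span T y -> eigen_span T (l2_plus x y).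
Proof.
intros Hx Hy eps; pose proof (cond_pos eps).
assert (P : 0 < eps / 2) by lra.
destruct (Hx (mkposreal _ P)) as [x' [X1 X2]], (Hy (mkposreal _ P)) as [y' [Y1 Y2]].
exists (l2_plus x' y'); split; [now apply (span_plus (H := l2_NormedModule)) |].
change (l2_norm (minus x' x) < eps / 2) in X2.
change (l2_norm (minus y' y) < eps / 2) in Y2.
change (l2_norm (minus (l2_plus x' y') (l2_plus x y)) < eps).
replace (minus (l2_plus x' y') (l2_plus x y)) with (l2_plus (minus x' x) (minus y' y)).
- pose proof (l2_norm_triangle (minus x' x) (minus y' y)); lra.
- apply l2_ext; intros n; simpl; ring.
Qed.

(** A bounded linear map that preserves the span preserves its closure. Applied with [A] a scalar
    multiplication and with [A] equal to [T]. *)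
Lemma eigen_span_image (T A : l2 -> l2) (x : l2) :
  is_linear (U := l2_NormedModule) (V := l2_NormedModule) A ->
  (forall y, linear_span (H := l2_NormedModule) (eigenvector (H := l2_NormedModule) T) y ->
     linear_span (H := l2_NormedModule) (eigenvector (H := l2_NormedModule) T) (A y)) ->
  eigen_span T x -> eigen_span T (A x).
Proof.
intros L HA Hx eps; pose proof (cond_pos eps).
destruct (linear_norm _ L) as [M [HM HB]].
assert (P : 0 < eps / M) by (apply Rdiv_lt_0_compat; lra).
destruct (Hx (mkposreal _ P)) as [y [Y1 Y2]]; exists (A y); split; [auto |].
change (l2_norm (minus y x) < eps / M) in Y2.
change (l2_norm (minus (A y) (A x)) < eps).
replace (minus (A y) (A x)) with (A (minus y x)) by exact (linear_minus A y x L).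
apply Rle_lt_trans with (1 := HB (minus y x)).
apply (Rmult_lt_compat_l M) in Y2; [| easy].
replace (M * (eps / M)) with (pos eps) in Y2 by (field; lra); exact Y2.
Qed.

Lemma eigen_span_scal (T : l2 -> l2) (c : C) (x : l2) :
  eigen_span T x -> eigen_span T (l2_scal c x).
Proof.
apply (eigen_span_image T (l2_scal c)).
- apply (is_linear_scal_r (K := C_AbsRing) (V := l2_NormedModule) c); exact Cmult_comm.
- intros y; apply (span_scal (H := l2_NormedModule)).
Qed.

Lemma eigen_span_invariant (T : l2 -> l2) (x : l2) :
  is_linear (U := l2_NormedModule) (V := l2_NormedModule) T -> eigen_span T x -> eigen_span T (T x).
Proof.
intros L; apply (eigen_span_image T T); [exact L |].
exact (span_eigen_invariant (H := l2_NormedModule) T L).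
Qed.

(** * Unit vectors: density of finite sequences and cyclicity of e_0 *)

Lemma unit_seq_summable (k : nat) : square_summable (unit_seq k).
Proof.
apply (ex_series_incr_n (V := R_NormedModule) _ (S k)).
apply (ex_series_ext (fun _ => Cmod (RtoC 0) ^ 2)); [| exact square_summable_zero].
intros n; unfold unit_seq; destruct (Nat.eqb_spec (S k + n) k); [lia | reflexivity].
Qed.

Definition unit_vec (k : nat) : l2 := mk_l2 (unit_seq k) (unit_seq_summable k).

Fixpoint truncation (x : nat -> C) (N : nat) : l2 :=
  match N with
  | O => l2_zero
  | S k => l2_plus (l2_scal (x k) (unit_vec k)) (truncation x k)
  end.

Lemma truncation_coord (x : nat -> C) (N n : nat) :
  truncation x N n = if Nat.ltb n N then x n else RtoC 0.
Proof.
induction N as [| N IH]; [reflexivity |].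
cbn [truncation]; simpl l2_seq; rewrite IH; unfold unit_seq.
destruct (Nat.eqb_spec n N), (Nat.ltb_spec n N), (Nat.ltb_spec n (S N)); try lia; subst; ring.
Qed.

Lemma truncation_norm (x : l2) (N : nat) :
  l2_norm (minus (truncation x (S N)) x) ^ 2 =
  Series (fun n => Cmod (x n) ^ 2) - sum_n (fun n => Cmod (x n) ^ 2) N.
Proof.
set (y := minus (truncation x (S N)) x).
assert (Y : forall n, y n = if Nat.ltb n (S N) then RtoC 0 else Copp (x n)).
{ intros n; change (y n) with (Cplus (truncation x (S N) n) (Copp (x n))).
  rewrite truncation_coord; destruct (Nat.ltb n (S N)); ring. }
rewrite l2_norm_sq.
rewrite (Series_incr_n (fun n => Cmod (x n) ^ 2) (S N)); [| lia | apply l2_summable].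
rewrite (Series_incr_n (fun n => Cmod (y n) ^ 2) (S N)); [| lia | apply l2_summable].
rewrite sum_n_Reals; simpl pred.
rewrite (sum_eq (fun n => Cmod (y n) ^ 2) (fun _ => 0)).
- rewrite sum_cte.
  rewrite (Series_ext (fun k => Cmod (y (S N + k)%nat) ^ 2)
             (fun k => Cmod (x (S N + k)%nat) ^ 2)); [ring |].
  intros n; rewrite Y; destruct (Nat.ltb_spec (S N + n) (S N)); [lia |].
  now rewrite Cmod_opp.
- intros n Hn; rewrite Y; destruct (Nat.ltb_spec n (S N)); [| lia].
  rewrite Cmod_0; ring.
Qed.

Lemma eigen_span_total (T : l2 -> l2) :
  (forall k, eigen_span T (unit_vec k)) -> forall x, eigen_span T x.
Proof.
intros HT x; apply eigen_span_closed; intros eps He.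
(* The radius is [eps ^ 2] because the tail of this series is the squared distance from [x] to its
   truncation. *)
destruct (Series_correct _ (l2_summable x) (ball (Series (fun n => Cmod (x n) ^ 2))
  (eps ^ 2))) as [N HN].
{ assert (P : 0 < eps ^ 2) by nra; now exists (mkposreal _ P). }
exists (truncation x (S N)); split.
- generalize (S N); intros n; induction n as [| n IH].
  + apply (closed_span_incl (H := l2_NormedModule)), (span_zero (H := l2_NormedModule)).
  + apply eigen_span_plus; [now apply eigen_span_scal | exact IH].
- specialize (HN N (le_n N)).
  change (Rabs (sum_n (fun n => Cmod (x n) ^ 2) N - Series (fun n => Cmod (x n) ^ 2))
          < eps ^ 2) in HN.
  apply Rabs_def2 in HN; pose proof (truncation_norm x N) as E.
  pose proof (l2_norm_ge0 (minus (truncation x (S N)) x)); nra.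
Qed.

Lemma Jt_offdiag_neq0 (l : R) (n : nat) : 0 < l -> Jt_offdiag l n <> RtoC 0.
Proof.
intros Hl E; apply RtoC_inj in E; revert E.
pose proof (pos_INR n); rewrite S_INR; apply Rgt_not_eq, Rdiv_lt_0_compat; [easy |].
apply sqrt_lt_R0; nra.
Qed.

Lemma jacobi_apply_unit_0 (a b : nat -> C) (n : nat) :
  jacobi_apply a b (unit_seq 0) n =
  Cplus (Cmult (b 0%nat) (unit_seq 0 n)) (Cmult (a 0%nat) (unit_seq 1 n)).
Proof.
destruct n as [| [| n]]; rewrite ?jacobi_apply_0, ?jacobi_apply_S; unfold unit_seq; simpl; ring.
Qed.

Lemma jacobi_apply_unit_S (a b : nat -> C) (k n : nat) :
  jacobi_apply a b (unit_seq (S k)) n =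
  Cplus (Cmult (a k) (unit_seq k n))
    (Cplus (Cmult (b (S k)) (unit_seq (S k) n)) (Cmult (a (S k)) (unit_seq (S (S k)) n))).
Proof.
rewrite jacobi_apply_shift; unfold unit_seq, shift_right; destruct n as [| n].
- destruct k; simpl; ring.
- destruct (Nat.eqb_spec n (S k)), (Nat.eqb_spec (S n) (S k)), (Nat.eqb_spec (S (S n)) (S k)),
    (Nat.eqb_spec (S n) k), (Nat.eqb_spec (S n) (S (S k))); try lia; subst; try ring.
  all: try (injection e as ->; ring).
  all: try (injection e0 as ->; ring).
Qed.

(** Column k of the matrix involves e_{k+1} with a nonzero coefficient; solving for it climbs from
    e_0 to every unit vector by invariance under J_t. *)
Lemma eigen_span_unit (l : R) (t : C) : 0 < l -> eigen_span (Jt_operator l t) (unit_vec 0) ->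
  forall k, eigen_span (Jt_operator l t) (unit_vec k).
Proof.
intros Hl H0.
assert (L : is_linear (U := l2_NormedModule) (V := l2_NormedModule) (Jt_operator l t))
  by apply jacobi_operator_is_linear.
intros k; induction k as [| | k IH0 IH1] using nat_ind2; [exact H0 | |].
- pose proof (Jt_offdiag_neq0 l 0 Hl).
  replace (unit_vec 1) with (l2_scal (Cinv (Jt_offdiag l 0))
    (l2_plus (Jt_operator l t (unit_vec 0)) (l2_scal (Copp t) (unit_vec 0)))).
  + apply eigen_span_scal, eigen_span_plus;
      [now apply eigen_span_invariant | now apply eigen_span_scal].
  + apply l2_ext; intros n; simpl l2_seq.
    rewrite jacobi_apply_unit_0; simpl Jt_diag; now field.
- pose proof (Jt_offdiag_neq0 l (S k) Hl).
  (* From column 1 on the diagonal entry is 0, so only [unit_vec k] has to be subtracted. *)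
  replace (unit_vec (S (S k))) with (l2_scal (Cinv (Jt_offdiag l (S k)))
    (l2_plus (Jt_operator l t (unit_vec (S k)))
       (l2_scal (Copp (Jt_offdiag l k)) (unit_vec k)))).
  + apply eigen_span_scal, eigen_span_plus;
      [now apply eigen_span_invariant | now apply eigen_span_scal].
  + apply l2_ext; intros n; simpl l2_seq.
    rewrite jacobi_apply_unit_S; simpl Jt_diag; now field.
Qed.

Lemma leg_vec_scal (c : C) (f : R -> C) (Hf : ccts f) (H : ccts (fun x => Cmult c (f x))) :
  leg_vec _ H = l2_scal c (leg_vec f Hf).
Proof.
rewrite (leg_vec_ext _ (fun x => Cplus (Cmult (c - RtoC 1) (f x)) (f x)) H
           (ccts_lin _ _ _ Hf Hf)) by (intros; ring).
rewrite (leg_vec_lin _ _ _ Hf Hf); apply l2_ext; intros n; simpl; ring.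
Qed.

Lemma ccts_scal (c : C) (f : R -> C) : ccts f -> ccts (fun x => Cmult c (f x)).
Proof. intros [? ?]; split; simpl; auto with cts. Qed.

Lemma ccts_real (q : R -> R) (f : R -> C) : cts q -> ccts f ->
  ccts (fun x => Cmult (RtoC (q x)) (f x)).
Proof. intros Hq [? ?]; split; simpl; auto with cts. Qed.

Lemma ccts_expo (k : C) : ccts (expo k).
Proof. exact (cderiv_ccts _ _ (expo_cderiv k)). Qed.

Lemma Cmult_eq_reg_l (a x y : C) : a <> RtoC 0 -> Cmult a x = Cmult a y -> x = y.
Proof.
intros Ha E; replace x with (Cmult (Cinv a) (Cmult a x)) by now field.
rewrite E; now field.
Qed.

(** * Exponential eigenvectors of J_t and their trigonometric multiples *)

Section Eigenvectors.

Context (l : R) (hl : 0 < l) (t : C).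

Let J := Jt_operator l t.
Let eigen := eigenvector (H := l2_NormedModule) J.

Lemma Jt_leg_vec_derive (f df : R -> C) (Hf : ccts f) (Hdf : ccts df) :
  cderiv f df ->
  J (leg_vec df Hdf) = l2_plus (l2_scal (Cmult Ci (RtoC l)) (leg_vec f Hf))
                               (l2_scal (boundary_form l t f) (unit_vec 0)).
Proof.
intros D; apply l2_ext; intros n; simpl l2_seq; now apply Jt_leg_seq_derive.
Qed.

Lemma il_neq0 : Cmult Ci (RtoC l) <> RtoC 0.
Proof. intros E; apply (f_equal snd) in E; simpl in E; lra. Qed.

(** If the two endpoint values agree, the boundary form is -2il f(1). *)
Lemma boundary_form_periodic (f : R -> C) : f 1 = f (-1) ->
  boundary_form l t f = RtoC 0 -> f 1 = RtoC 0.
Proof.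
intros E B; unfold boundary_form in B; rewrite <- E in B.
apply (Cmult_eq_reg_l _ _ _ il_neq0).
replace (Cmult (Cmult Ci (RtoC l)) (f 1)) with
  (Cmult (RtoC (- / 2)) (Cminus (Cmult (t - Ci * RtoC l) (f 1)) (Cmult (t + Ci * RtoC l) (f 1)))).
- rewrite B; ring.
- replace (RtoC (- / 2)) with (Copp (Cinv (Cplus (RtoC 1) (RtoC 1)))).
  + field; intros F; apply (f_equal fst) in F; simpl in F; lra.
  + rewrite <- RtoC_plus, <- RtoC_inv, <- RtoC_opp by lra; f_equal; field.
Qed.

(** For E = [expo k] the derivative is k E, so k J E = il E and the eigenvalue is il/k. The
    condition forces E(1) <> E(-1), since E has no zeros; this gives both k <> 0 and a nonzero
    coordinate 0. *)
Lemma expo_eigen (k : C) (H : ccts (expo k)) :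
  boundary_form l t (expo k) = RtoC 0 -> eigen (leg_vec (expo k) H).
Proof.
intros B; pose proof (expo_cderiv k) as D.
assert (NP : expo k 1 <> expo k (-1)).
{ intros E; exact (expo_neq0 k 1 (boundary_form_periodic _ E B)). }
assert (K : k <> RtoC 0).
{ intros ->; apply NP; unfold expo; simpl; rewrite !Rmult_0_l; reflexivity. }
pose proof (Jt_leg_vec_derive _ _ H (ccts_scal k _ H) D) as JE.
rewrite B, (leg_vec_scal k _ H) in JE.
split.
- intros Z; apply NP.
  pose proof (leg_seq_derive_0 _ _ D (ccts_scal k _ H)) as E.
  change (leg_vec _ (ccts_scal k _ H) 0%nat = Cminus (expo k 1) (expo k (-1))) in E.
  rewrite (leg_vec_scal k _ H) in E; change (leg_vec (expo k) H = l2_zero) in Z.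
  rewrite Z in E; simpl in E.
  replace (expo k 1) with (Cplus (Cminus (expo k 1) (expo k (-1))) (expo k (-1))) by ring.
  rewrite <- E; ring.
- exists (Cdiv (Cmult Ci (RtoC l)) k).
  assert (L : J (l2_scal k (leg_vec (expo k) H)) = l2_scal k (J (leg_vec (expo k) H))).
  { apply (linear_scal (U := l2_NormedModule) (V := l2_NormedModule) J
             (jacobi_operator_is_linear _ _ _ _)). }
  rewrite L in JE; apply l2_ext; intros n; apply (f_equal (fun v : l2 => v n)) in JE.
  simpl l2_seq in JE |- *.
  apply (Cmult_eq_reg_l _ _ _ K).
  rewrite JE; now field.
Qed.

(** Quantifying over all admissible [k] at once makes the class stable under factors exp(i pi x) and
    exp(-i pi x), which only move [k]. The span is not closed here; the limit is taken once, in
    [eigen_span_id_expo]. *)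
Definition expo_multiplier (q : R -> R) : Prop :=
  cts q /\ forall k (H : ccts (fun x => Cmult (RtoC (q x)) (expo k x))),
    boundary_form l t (expo k) = RtoC 0 ->
    linear_span (H := l2_NormedModule) eigen (leg_vec _ H).

Lemma expo_multiplier_ext (p q : R -> R) :
  (forall x, p x = q x) -> expo_multiplier p -> expo_multiplier q.
Proof.
intros E [Cp Hp]; split.
- intros x; apply (continuous_ext p); [exact E | apply Cp].
- intros k H B.
  rewrite (leg_vec_ext _ _ H (ccts_real p _ Cp (ccts_expo k))) by (intros; now rewrite E).
  now apply Hp.
Qed.

Lemma expo_multiplier_1 : expo_multiplier (fun _ => 1).
Proof.
split; [apply cts_const |]; intros k H B.
rewrite (leg_vec_ext _ _ H (ccts_expo k)) by (intros; ring).
apply (span_incl (H := l2_NormedModule)); now apply expo_eigen.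
Qed.

Lemma expo_multiplier_lin (a : R) (p q : R -> R) :
  expo_multiplier p -> expo_multiplier q -> expo_multiplier (fun x => a * p x + q x).
Proof.
intros [Cp Hp] [Cq Hq]; split; [auto with cts |]; intros k H B.
pose proof (ccts_real p _ Cp (ccts_expo k)) as Fp.
pose proof (ccts_real q _ Cq (ccts_expo k)) as Fq.
rewrite (leg_vec_ext _ _ H (ccts_lin (RtoC a) _ _ Fp Fq))
  by (intros; rewrite RtoC_plus, RtoC_mult; ring).
rewrite (leg_vec_lin _ _ _ Fp Fq).
apply (span_plus (H := l2_NormedModule)); [| now apply Hq].
apply (span_scal (H := l2_NormedModule)); now apply Hp.
Qed.

Lemma expo_multiplier_scal (a : R) (p : R -> R) :
  expo_multiplier p -> expo_multiplier (fun x => a * p x).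
Proof.
intros Hp; apply (expo_multiplier_ext (fun x => (a - 1) * p x + p x)); [intros; ring |].
now apply expo_multiplier_lin.
Qed.

(** A factor exp(i pi x) or exp(-i pi x) is absorbed into the exponential, whose shifted exponent is
    admissible by [boundary_form_shift]. *)
Lemma expo_multiplier_mult (q g : R -> R) (c c' : C) : cts g ->
  (forall x, RtoC (g x) = Cplus (Cmult c (expo (RtoC 1 * ipi) x))
                                (Cmult c' (expo (RtoC (-1) * ipi) x))) ->
  expo_multiplier q -> expo_multiplier (fun x => g x * q x).
Proof.
intros Cg Hg [Cq Hq]; split; [auto with cts |]; intros k H B.
pose proof (ccts_real q _ Cq (ccts_expo (k + RtoC 1 * ipi))) as F1.
pose proof (ccts_real q _ Cq (ccts_expo (k + RtoC (-1) * ipi))) as F2.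
rewrite (leg_vec_ext _ _ H (ccts_lin c _ _ F1 (ccts_scal c' _ F2)))
  by (intros; rewrite RtoC_mult, Hg, !expo_plus; ring).
rewrite (leg_vec_lin _ _ _ F1 (ccts_scal c' _ F2)), (leg_vec_scal _ _ F2).
assert (B' : forall s, s = 1 \/ s = -1 -> boundary_form l t (expo (k + RtoC s * ipi)) = RtoC 0).
{ intros s Hs; rewrite boundary_form_shift, B by exact Hs; ring. }
apply (span_plus (H := l2_NormedModule));
  apply (span_scal (H := l2_NormedModule)); apply Hq; auto.
Qed.

Lemma expo_ipi (s x : R) : expo (RtoC s * ipi) x = (cos (s * (PI * x)), sin (s * (PI * x))).
Proof.
unfold expo, ipi; simpl.
replace ((s * 0 - 0 * PI) * x) with 0 by ring.
replace ((s * PI + 0 * 0) * x) with (s * (PI * x)) by ring.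
rewrite exp_0; f_equal; ring.
Qed.

Lemma expo_ipi_opp (x : R) : expo (RtoC (-1) * ipi) x = (cos (PI * x), - sin (PI * x)).
Proof.
rewrite expo_ipi; replace (-1 * (PI * x)) with (- (PI * x)) by ring.
now rewrite cos_neg, sin_neg.
Qed.

Lemma expo_multiplier_hsin2 (q : R -> R) :
  expo_multiplier q -> expo_multiplier (fun x => hsin x ^ 2 * q x).
Proof.
intros Hq; apply (expo_multiplier_ext (fun x => - / 2 * (cos (PI * x) * q x) + / 2 * q x)).
{ intros x; unfold hsin; replace (PI * x) with (2 * (PI / 2 * x)) by field.
  rewrite cos_2a_sin; field. }
apply expo_multiplier_lin; [| now apply expo_multiplier_scal].
apply (expo_multiplier_mult q (fun x => cos (PI * x)) (RtoC (/ 2)) (RtoC (/ 2))); [| | exact Hq].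
- apply (cts_derive _ (fun x => - PI * sin (PI * x))); intros x.
  auto_derive; [trivial | ring].
- intros x; rewrite expo_ipi_opp, expo_ipi, Rmult_1_l.
  unfold RtoC, Cplus, Cmult; simpl; f_equal; field.
Qed.

Lemma expo_multiplier_hsin_hcos : expo_multiplier (fun x => hsin x * hcos x).
Proof.
apply (expo_multiplier_ext (fun x => / 2 * (sin (PI * x) * 1))).
{ intros x; unfold hsin, hcos; replace (PI * x) with (2 * (PI / 2 * x)) by field.
  rewrite sin_2a; field. }
apply expo_multiplier_scal.
(* The pairs are -i/2 and i/2, the coefficients in Euler's formula for the sine. *)
apply (expo_multiplier_mult _ (fun x => sin (PI * x)) (0, - / 2) (0, / 2)); [| | apply expo_multiplier_1].
- apply (cts_derive _ (fun x => PI * cos (PI * x))); intros x.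
  auto_derive; [trivial | ring].
- intros x; rewrite expo_ipi_opp, expo_ipi, Rmult_1_l.
  unfold RtoC, Cplus, Cmult; simpl; f_equal; field.
Qed.

Lemma expo_multiplier_hsin_pow_hcos (n : nat) :
  expo_multiplier (fun x => hsin x ^ (2 * n) * (hsin x * hcos x)).
Proof.
induction n as [| n IH].
- apply (expo_multiplier_ext (fun x => hsin x * hcos x)); [intros; simpl; ring |].
  apply expo_multiplier_hsin_hcos.
- apply (expo_multiplier_ext (fun x => hsin x ^ 2 * (hsin x ^ (2 * n) * (hsin x * hcos x)))).
  + intros x; replace (2 * S n)%nat with (2 + 2 * n)%nat by lia; rewrite pow_add; ring.
  + now apply expo_multiplier_hsin2.
Qed.

Lemma expo_multiplier_id_sub_saw (n : nat) : expo_multiplier (fun x => x - saw n x).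
Proof.
induction n as [| n IH].
- apply (expo_multiplier_ext (fun x => 0 * 1)); [intros; simpl; ring |].
  apply expo_multiplier_scal, expo_multiplier_1.
- set (g := / (PI / 2 * (2 * INR n + 2) * wallis (S n))).
  apply (expo_multiplier_ext (fun x => g * (hsin x ^ (2 * n) * (hsin x * hcos x)) + (x - saw n x))).
  { intros x; change (saw (S n) x) with (saw n x - g * (hsin x ^ (2 * n) * (hsin x * hcos x))).
    ring. }
  apply expo_multiplier_lin; [apply expo_multiplier_hsin_pow_hcos | exact IH].
Qed.

(** (x - saw n x) E(x) is in the span, and its distance to x E(x) is the norm of the image of saw n
    x E(x), which [Int_saw_small] makes arbitrarily small. *)
Lemma eigen_span_id_expo (k : C) (H : ccts (fun x => Cmult (RtoC x) (expo k x))) :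
  boundary_form l t (expo k) = RtoC 0 -> eigen_span J (leg_vec _ H).
Proof.
intros B; apply eigen_span_closed; intros eps He.
set (M := exp (2 * Rabs (fst k))).
assert (HM : 0 < M) by apply exp_pos.
(* [M] bounds the squared modulus of [expo k] on [-1, 1]; the 2 absorbs the factor in
   [leg_vec_norm]. *)
destruct (Int_saw_small (eps ^ 2 / (2 * M))) as [n Hn].
{ apply Rdiv_lt_0_compat; nra. }
destruct (expo_multiplier_id_sub_saw n) as [Cn Hs].
pose proof (ccts_real _ _ Cn (ccts_expo k)) as Fn.
pose proof (ccts_real _ _ (cts_saw n) (ccts_expo k)) as Gn.
exists (leg_vec _ Fn); split; [apply (closed_span_incl (H := l2_NormedModule)); now apply Hs |].
assert (E : minus (leg_vec _ Fn) (leg_vec _ H) = l2_scal (Copp (RtoC 1)) (leg_vec _ Gn)).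
{ rewrite (leg_vec_ext _ _ Fn (ccts_lin (Copp (RtoC 1)) _ _ Gn H))
    by (intros; rewrite RtoC_minus; ring).
  rewrite (leg_vec_lin _ _ _ Gn H); apply l2_ext; intros m; simpl; ring. }
rewrite E, l2_norm_scal, Cmod_opp, Cmod_1, Rmult_1_l.
pose proof (leg_vec_norm _ Gn) as N.
assert (I : Int (fun x => Cmod (Cmult (RtoC (saw n x)) (expo k x)) ^ 2)
            <= M * Int (fun x => saw n x ^ 2)).
{ assert (X : forall x, Cmod (Cmult (RtoC (saw n x)) (expo k x)) ^ 2
                        = saw n x ^ 2 * exp (2 * fst k * x)).
  { intros x; rewrite Cmod_mult, Rpow_mult_distr, Cmod_expo2, Cmod_R, pow2_abs; reflexivity. }
  assert (Ce : cts (fun x => exp (2 * fst k * x))).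
  { apply (cts_derive _ (fun x => 2 * fst k * exp (2 * fst k * x))); intros x.
    auto_derive; [trivial | ring]. }
  rewrite (Int_ext _ _ X), <- Int_scal by auto with cts.
  apply Int_le; auto with cts; intros x Hx.
  rewrite Rmult_comm; apply Rmult_le_compat_r; [apply pow2_ge_0 |].
  assert (A : 2 * fst k * x <= 2 * Rabs (fst k)).
  { pose proof (Rle_abs (fst k)); pose proof (Rle_abs (- fst k)) as A'.
    rewrite Rabs_Ropp in A'; nra. }
  unfold M; destruct A as [A | ->]; [left; now apply exp_increasing | lra]. }
apply (Rmult_lt_compat_l M) in Hn; [| easy].
replace (M * (eps ^ 2 / (2 * M))) with (eps ^ 2 / 2) in Hn by (field; lra).
pose proof (l2_norm_ge0 (leg_vec _ Gn)); nra.
Qed.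

(** With f = x E, both f and f' = k f + E lie in the closed span, hence so does J f' - il f = b e_0.
    As f(-1) = -E(-1), the boundary condition on E gives b = 2 (t - il) E(1), which is nonzero. *)
Lemma eigen_span_unit_0 (k : C) : Cminus t (Ci * RtoC l) <> RtoC 0 ->
  boundary_form l t (expo k) = RtoC 0 -> eigen_span J (unit_vec 0).
Proof.
intros Ht B.
set (f := fun x => Cmult (RtoC x) (expo k x)).
set (df := fun x => Cplus (Cmult k (f x)) (expo k x)).
pose proof (ccts_expo k) as CE.
pose proof (ccts_real _ _ cts_id CE) as Cf; fold f in Cf.
pose proof (ccts_lin k _ _ Cf CE) as Cdf; fold df in Cdf.
assert (D : cderiv f df).
{ split; intros x; unfold f, df, expo; simpl; auto_derive; auto; ring. }
pose proof (Jt_leg_vec_derive f df Cf Cdf D) as JE.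
set (b := boundary_form l t f) in JE.
assert (Hb : b = Cmult (RtoC 2) (Cmult (t - Ci * RtoC l) (expo k 1))).
{ transitivity (Cminus (Cmult (RtoC 2) (Cmult (t - Ci * RtoC l) (expo k 1)))
                       (boundary_form l t (expo k))).
  - unfold b, boundary_form, f.
    replace (RtoC (-1)) with (Copp (RtoC 1)) by (now rewrite <- RtoC_opp).
    replace (RtoC 2) with (Cplus (RtoC 1) (RtoC 1)) by (rewrite <- RtoC_plus; f_equal; ring).
    ring.
  - rewrite B; ring. }
assert (Nb : b <> RtoC 0).
{ rewrite Hb; apply Cmult_neq_0; [intros E; apply (f_equal fst) in E; simpl in E; lra |].
  apply Cmult_neq_0; [exact Ht | apply expo_neq0]. }
assert (WE : eigen_span J (leg_vec _ CE)).
{ apply (closed_span_incl (H := l2_NormedModule)), (span_incl (H := l2_NormedModule)); now apply expo_eigen. }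
assert (Wf : eigen_span J (leg_vec _ Cf)) by now apply eigen_span_id_expo.
replace (unit_vec 0) with (l2_scal (Cinv b) (l2_plus (J (leg_vec df Cdf))
  (l2_scal (Copp (Cmult Ci (RtoC l))) (leg_vec f Cf)))).
- apply eigen_span_scal, eigen_span_plus; [| now apply eigen_span_scal].
  apply eigen_span_invariant; [apply jacobi_operator_is_linear |].
  unfold df; rewrite (leg_vec_lin k _ _ Cf CE).
  apply eigen_span_plus; [now apply eigen_span_scal | exact WE].
- rewrite JE; apply l2_ext; intros n; simpl l2_seq; now field.
Qed.

End Eigenvectors.

Theorem theorem7p5 (l : R) (hl : (0 < l)%R) (t : C)
    (ht_plus : t <> (Ci * RtoC l)%C) (ht_minus : t <> (- (Ci * RtoC l))%C) :
  complete_system_of_eigenvectors (H := l2_NormedModule) (Jt_operator l t).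
Proof.
assert (H1 : Cminus t (Ci * RtoC l) <> RtoC 0).
{ intros E; apply ht_plus.
  replace t with (Cplus (Cminus t (Ci * RtoC l)) (Ci * RtoC l)) by ring.
  rewrite E; ring. }
assert (H2 : Cplus t (Ci * RtoC l) <> RtoC 0).
{ intros E; apply ht_minus.
  replace t with (Cminus (Cplus t (Ci * RtoC l)) (Ci * RtoC l)) by ring.
  rewrite E; ring. }
destruct (boundary_form_solvable l t H1 H2) as [k B].
intros x; apply eigen_span_total, eigen_span_unit, (eigen_span_unit_0 l hl t k H1 B); exact hl.
Qed.
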